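(* Let $0<p<1$ and let $(m_n)_{n\ge1}$ be integers with $1\le m_n\le n$, $m_n\to\infty$ and $m_n/n\to0$ as $n\to\infty$. Write $m=m_n$, and let $S_n=\sum_{k=1}^n X_k$ be the position at time $n$ of the elephant random walk with parameter $p$ and memory restricted to the first $m_n$ steps. Then, with convergence in distribution as $n\to\infty$: (a) If $0<p<3/4$, then $\dfrac{S_n\sqrt{m}}{n}\xrightarrow{d}\mathcal N_{0,\,(2p-1)^2/(3-4p)}$. (b) If $p=3/4$, then $\dfrac{S_n\sqrt{m/\log m}}{n}\xrightarrow{d}\mathcal N_{0,\,1/4}$. (c) If $3/4<p<1$, then $\dfrac{S_n\,m^{2(1-p)}}{n}\xrightarrow{d}(2p-1)\,L$, where $L$ is the almost sure limit of $\widetilde S_j/j^{2p-1}$ as $j\to\infty$ for the full-memory elephant random walk $(\widetilde S_j)_{j\ge 1}$ with the same parameter $p$.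
   Context: Full-memory elephant random walk (ERW) with parameter $p$: $\widetilde X_1=1$ with probability $p$ and $\widetilde X_1=-1$ with probability $1-p$. Given $\widetilde X_1,\dots,\widetilde X_k$, one sets $\widetilde X_{k+1}=+\widetilde X_K$ with probability $p$ and $\widetilde X_{k+1}=-\widetilde X_K$ with probability $1-p$, where $K$ is uniform on $\{1,\dots,k\}$, and the choice of $K$ and of the sign are independent of each other and of the past. Put $\widetilde S_j=\sum_{k=1}^j\widetilde X_k$. For $3/4<p<1$ it is known that $\widetilde S_j/j^{2p-1}$ converges almost surely (and in $L^2$) to a random variable denoted $L$. ERW with memory restricted to the first $m_n$ steps (triangular scheme): for each $n$, with $m=m_n$, the steps $X_1,\dots,X_n$ (more precisely $X_{n,1},\dots,X_{n,n}$; the index $n$ is suppressed) are defined as follows. $X_1,\dots,X_m$ are the first $m$ steps of a full-memory ERW with parameter $p$. For $m\le k<n$, given $X_1,\dots,X_k$, $X_{k+1}=+X_K$ with probability $p$ and $-X_K$ with probability $1-p$, where $K$ is uniform on $\{1,\dots,m\}$, and $K$ and the sign are independent of each other and of the past. $\mathcal N_{0,\sigma^2}$ is the normal distribution with mean $0$ and variance $\sigma^2$, where $\mathcal N_{0,0}$ is the point mass at $0$. *)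

(* Defs.v *)
From HB Require Import structures.
From mathcomp Require Import all_boot all_order all_algebra.
From mathcomp Require Import all_classical all_reals all_analysis.
From mathcomp Require Import measurable_realfun.

Set Implicit Arguments.
Unset Strict Implicit.
Unset Printing Implicit Defensive.

Import Order.TTheory GRing.Theory Num.Theory.
Import numFieldNormedType.Exports.

Local Open Scope classical_set_scope.
Local Open Scope ring_scope.

Section independence.
Context {d : measure_display} {T : measurableType d} {R : realType}.

Definition sigma_rv {d' : measure_display} {T' : measurableType d'}
    (X : T -> T') : set (set T) :=
  preimage_set_system [set: T] X measurable.

(* Mutual independence of three sigma-algebras: since each of them contains
   [set: T], the product rule for triples entails the one for pairs. *)
Definition independent3 (P : probability T R) (F G H : set (set T)) : Prop :=
  forall A B C, F A -> G B -> H C ->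
    P (A `&` B `&` C) = (P A * P B * P C)%E.

End independence.

Section elephant_random_walk.
Context {d : measure_display} {T : measurableType d} {R : realType}.
Variable P : probability T R.
Implicit Types (p : R) (X : nat -> {RV P >-> R}) (k r m n : nat).

(* Steps are indexed from 1; X 0 only occurs on a null event, when K is 0. *)

Definition past X k : set (set T) :=
  <<s \bigcup_(i in [set i : nat | (1 <= i <= k)%N]) sigma_rv (X i) >>.

Definition erw_init p X : Prop :=
  P (X 1%N @^-1` [set 1]) = p%:E /\ P (X 1%N @^-1` [set -1]) = (1 - p)%:E.

(* K is uniform on {1, ..., r}: the r values of mass 1/r exhaust the total mass. *)
Definition erw_step p X k r : Prop :=
  exists (K : {RV P >-> nat}) (e : {RV P >-> R}),
  [/\ forall i : nat, (1 <= i <= r)%N -> P (K @^-1` [set i]) = (r%:R^-1)%:E,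
      P (e @^-1` [set 1]) = p%:E,
      P (e @^-1` [set -1]) = (1 - p)%:E,
      independent3 P (past X k) (sigma_rv K) (sigma_rv e) &
      {ae P, forall w, X k.+1 w = e w * X (K w) w}].

Definition full_erw p X : Prop :=
  erw_init p X /\ forall k, (1 <= k)%N -> erw_step p X k k.

(* Meant for 1 <= m <= n; only X_1, ..., X_n are constrained. *)
Definition restricted_erw p m n X : Prop :=
  [/\ erw_init p X,
      forall k, (1 <= k < m)%N -> erw_step p X k k &
      forall k, (m <= k < n)%N -> erw_step p X k m].

Definition walk X n : {RV P >-> R} :=
  \sum_(1 <= k < n.+1) (X k : {mfun T >-> R}).

End elephant_random_walk.

Section convergence_in_distribution.
Context {R : realType}.

Definition law_cdf (mu : set R -> \bar R) (x : R) : R :=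
  fine (mu `]-oo, x]%classic).

(* Y_ n --> mu in distribution, where mu is a law on R and Y_ n is defined on
   its own probability space (T n, P n). *)
Definition cvg_in_distribution (d : nat -> measure_display)
    (T : forall n : nat, measurableType (d n))
    (P : forall n : nat, probability (T n) R)
    (Y_ : forall n : nat, {RV (P n) >-> R}) (mu : set R -> \bar R) : Prop :=
  forall x : R, {for x, continuous (law_cdf mu)} ->
    fine (cdf (Y_ n) x) @[n --> \oo] --> law_cdf mu x.

(* Parameterised by the variance v; normal_prob takes the standard deviation,
   and normal_prob 0 0 is the uniform law on [0, 1], not the point mass. *)
Definition centered_gaussian (v : R) : set R -> \bar R :=
  if v == 0 then \d_(0 : R) else normal_prob 0 (Num.sqrt v).

End convergence_in_distribution.
Arguments cvg_in_distribution {R d T} P Y_ mu.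

(* Main.v *)
Require Import Defs.
From HB Require Import structures.
From mathcomp Require Import all_boot all_order all_algebra.
From mathcomp Require Import all_classical all_reals all_analysis.
From mathcomp Require Import measurable_realfun.
From mathcomp Require Import ring lra.

Set Implicit Arguments.
Unset Strict Implicit.
Unset Printing Implicit Defensive.

Import Order.TTheory GRing.Theory Num.Theory.
Import numFieldNormedType.Exports.

Local Open Scope classical_set_scope.
Local Open Scope ring_scope.

(** Write [a = 2 * p - 1] and [m] for [m n].

    Restricted memory.  Given the first [m] steps, the later ones are signs of
    mean [a * S_m / m], so that [S_n] differs from
    [(1 + (n - m) * a / m) * S_m] by a variable whose second moment is at most
    [4 * n] ([excess_mean_sqr]).  In all three regimes the normalising factor
    times [sqrt n] tends to 0, and the limit law is that of a multiple of
    [S_m], the full-memory walk at time [m] ([restricted_smooth]).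

    Full memory.  The position is a Markov chain: the step at time [k + 1] is 1
    with probability [(1 + a * S_k / k) / 2].  The expectation of a function of
    [S_m] is therefore given by an explicit recursion, [erw_mean]
    ([full_erw_law]).  In case (c) this replaces [S_m] by the position at time
    [m] of the walk that defines [L], and dominated convergence concludes
    ([restricted_superdiffusive]).

    Cases (a) and (b) need a central limit theorem for the chain ([erw_clt]).
    Its test functions are [y |-> Phi ((x - c * y) / s)], where [Phi] is the
    standard normal distribution function.  Since [Phi (z / sqrt v)] solves the
    heat equation, averaging over one centred step of the chain amounts, up to
    a small error, to replacing [s ^ 2] by [s ^ 2 + c ^ 2] ([heat_step]), while
    the drift of the step replaces [c] by [c * (1 + a / k)].  Going back to the
    first step gives [Phi (x / sqrt (s ^ 2 + c ^ 2 * t_m))], where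
    [t_(k+1) = (1 + a / k) ^ 2 * t_k + 1] ([erw_heat_bound]).  Comparing this
    recurrence with [w_k = k] when [a < 1 / 2], and with [w_k = k * ln k] when
    [a = 1 / 2], yields [t_m / w_m --> 1 / lambda], with [lambda = 1 - 2 * a]
    and [lambda = 1] respectively ([rec_sum1_cvg]); this is the variance of
    the limit, up to the factor [a ^ 2].

    Finally, distribution functions are squeezed between expectations of such
    test functions with small [s] ([cvg_in_distribution_smooth]). *)

(** * The standard normal distribution function *)

Section normal_cdf.
Context {R : realType}.
Implicit Types x y z s t v c h : R.

(** The functions [z |-> Phi (z / sqrt v)] are the test functions of the whole
    proof: they solve the heat equation in [(v, z)], and for small [v] they
    are close to the indicator function of the positive half-line. *)
Definition Phi : R -> R := law_cdf (normal_prob 0 1).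
Definition phi : R -> R := normal_pdf 0 1.

Lemma is_derive_normal_cdf s x : s != 0 ->
  is_derive x 1 (law_cdf (normal_prob 0 s)) (normal_pdf 0 s x).
Proof.
move=> s0.
have h1 : x < x + 1 by rewrite ltrDl.
have h2 : lebesgue_measure.-integrable `]-oo, x + 1] (EFin \o normal_pdf 0 s).
  apply: (integrableS _ _ (subsetT _)) => //; exact: integrable_normal_pdf.
have [dF fE] := continuous_FTC1 h1 h2 (ltNyr _) (@continuous_normal_pdf _ _ _ s0 x).
have -> : law_cdf (normal_prob 0 s) =
    fun y => \int[lebesgue_measure]_(t in `]-oo, y]) normal_pdf 0 s t by [].
by apply: DeriveDef; [exact: dF|rewrite derive1E in fE].
Qed.

Lemma law_cdf_ge0 (mu : probability (measurableTypeR R) R) x : 0 <= law_cdf mu x.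
Proof. exact: fine_ge0. Qed.

Lemma law_cdf_le1 (mu : probability (measurableTypeR R) R) x : law_cdf mu x <= 1.
Proof.
rewrite /law_cdf -lee_fin fineK; first exact: probability_le1.
exact: fin_num_measure.
Qed.

Lemma law_cdf_nondecreasing (mu : probability (measurableTypeR R) R) :
  {homo law_cdf mu : x y / x <= y}.
Proof.
move=> x y xy; rewrite /law_cdf fine_le ?fin_num_measure//.
by rewrite le_measure ?inE//; exact: subitvPr.
Qed.

Let idR : measurableTypeR R -> R := idfun.
HB.instance Definition _ :=
  @isMeasurableFun.Build _ _ _ _ idR (@measurable_id _ _ setT).

Lemma law_cdf_cvgy (mu : probability (measurableTypeR R) R) :
  law_cdf mu x @[x --> +oo] --> (1 : R).
Proof. exact: (fine_cvg (cvg_cdfy1 (idR : {RV mu >-> R}))). Qed.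

Lemma law_cdf_cvgNy (mu : probability (measurableTypeR R) R) :
  law_cdf mu x @[x --> -oo] --> (0 : R).
Proof. exact: (fine_cvg (cvg_cdfNy0 (idR : {RV mu >-> R}))). Qed.

Lemma Phi_ge0 x : 0 <= Phi x. Proof. exact: (law_cdf_ge0 (normal_prob 0 1)). Qed.

Lemma Phi_le1 x : Phi x <= 1. Proof. exact: (law_cdf_le1 (normal_prob 0 1)). Qed.

Lemma ler_Phi : {homo Phi : x y / x <= y}.
Proof. exact: (law_cdf_nondecreasing (normal_prob 0 1)). Qed.

Lemma is_derive_Phi x : is_derive x 1 Phi (phi x).
Proof. by apply: is_derive_normal_cdf. Qed.

Lemma phiE x : phi x = normal_peak 1 * expR (- (x ^+ 2 / 2)).
Proof.
rewrite /phi normal_pdfE// /normal_fun; congr (_ * expR _).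
by rewrite subr0 expr1n mulNr.
Qed.

Lemma is_derive_phi x : is_derive x 1 phi (- x * phi x).
Proof.
have -> : phi = fun y => normal_peak 1 * expR (- (y ^+ 2 / 2)).
  by apply/funext => y; rewrite phiE.
apply: is_derive_eq => /=.
by rewrite /GRing.scale /=; field.
Qed.

Lemma phi_ge0 x : 0 <= phi x. Proof. exact: normal_pdf_ge0. Qed.

Lemma normal_peak1_le1 : normal_peak (1 : R) <= 1.
Proof.
rewrite /normal_peak expr1n mul1r invf_le1 ?sqrtr_gt0; last first.
  by rewrite pmulrn_lgt0// pi_gt0.
rewrite -[leLHS]sqrtr1 ler_sqrt//; last by rewrite mulrn_wge0// pi_ge0.
by have := @pi_ge2 R; lra.
Qed.

Lemma phi_le x : phi x <= expR (- (x ^+ 2 / 2)).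
Proof. by rewrite phiE ler_piMl ?expR_ge0// normal_peak1_le1. Qed.

Lemma phi_le1 x : phi x <= 1.
Proof.
apply: (le_trans (phi_le x)); rewrite -[leRHS]expR0 ler_expR oppr_le0.
by rewrite divr_ge0// sqr_ge0.
Qed.

(** This bound and the next one control the derivatives of [Phi], which are
    polynomials times [phi], through [1 + u <= expR u]. *)
Lemma sqr_phi_le x : x ^+ 2 * phi x <= 2.
Proof.
have := phi_le x; set y := x ^+ 2 => h.
have y0 : 0 <= y by exact: sqr_ge0.
have e1 : 1 + y / 2 <= expR (y / 2) by exact: expR_ge1Dx.
rewrite expRN in h.
have e0 := expR_gt0 (y / 2).
have : phi x * expR (y / 2) <= 1 by rewrite -ler_pdivlMr// mul1r.
have := phi_ge0 x; nra.
Qed.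

Lemma quad_phi_le x : x ^+ 4 * phi x <= 16.
Proof.
have := phi_le x.
have -> : x ^+ 4 = (x ^+ 2) ^+ 2 by ring.
set y := x ^+ 2 => h.
have y0 : 0 <= y by exact: sqr_ge0.
have e1 : 1 + y / 4 <= expR (y / 4) by exact: expR_ge1Dx.
rewrite expRN in h.
have e0 := expR_gt0 (y / 2).
have : phi x * expR (y / 2) <= 1 by rewrite -ler_pdivlMr// mul1r.
have -> : y / 2 = y / 4 + y / 4 by lra.
rewrite expRD => P1.
have := phi_ge0 x => P0.
have : (y / 4) * (y / 4) <= expR (y / 4) * expR (y / 4) by apply: ler_pM; lra.
move=> P2; have := ler_wpM2l P0 P2; lra.
Qed.

Lemma normal_peakE s : 0 < s -> normal_peak s = s^-1 * normal_peak 1.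
Proof.
move=> s0; rewrite /normal_peak expr1n mul1r.
rewrite -[X in Num.sqrt X]mulrnAr sqrtrM ?sqr_ge0// sqrtr_sqr gtr0_norm//.
by rewrite invfM.
Qed.

(** Both sides have the same derivative in [x] and tend to 0 at [-oo]. *)
Lemma normal_cdfE s x : 0 < s -> law_cdf (normal_prob 0 s) x = Phi (x / s).
Proof.
move=> s0.
have sn0 : s != 0 by rewrite gt_eqF.
pose D y := law_cdf (normal_prob 0 s) y - Phi (y / s).
have dD y : is_derive y 1 D 0.
  have h1 := is_derive_normal_cdf y sn0.
  have h2 : is_derive y 1 (fun y => Phi (y / s)) (phi (y / s) * s^-1).
    have h3 := is_derive_Phi (y / s).
    have h4 : is_derive y 1 (fun y => y / s) (s^-1).
      by apply: is_derive_eq; rewrite /GRing.scale/=; ring.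
    exact: (@is_derive1_comp R Phi (fun y => y / s) y _ _ h3 h4).
  have := is_deriveB h1 h2; rewrite /D.
  suff -> : normal_pdf 0 s y - phi (y / s) * s^-1 = 0 by [].
  rewrite [_ * s^-1]mulrC.
  rewrite /phi !normal_pdfE// normal_peakE// /normal_fun.
  apply/eqP; rewrite subr_eq0 mulrA; apply/eqP; congr (_ * expR _).
  have -> : s ^+ 2 *+ 2 = s ^+ 2 * 2 by rewrite mulr_natr.
  by rewrite expr1n !subr0; field.
have Dcst y : D y = D x.
  apply: is_derive_0_is_cst => z; exact: dD.
have : D y @[y --> -oo] --> (0 : R).
  rewrite -[X in _ --> X](subr0 0); apply: cvgB; first exact: (law_cdf_cvgNy (normal_prob 0 _)).
  apply: (@cvg_comp _ _ _ (fun y => y / s) Phi _ -oo).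
    apply: gt0_cvgMlNy; last exact: cvg_id.
    by rewrite invr_gt0.
  exact: (law_cdf_cvgNy (normal_prob 0 _)).
have -> : (fun y => D y) = fun=> D x by apply/funext.
move=> h; have /cvg_unique := h; move/(_ (@Rhausdorff R) _ (cvg_cst (D x))).
by rewrite /D; move/eqP; rewrite eq_sym subr_eq0 => /eqP.
Qed.

End normal_cdf.

(** * One step of the heat flow *)

Section heat_step.
Context {R : realType}.
Implicit Types x y z s t v c h K M : R.

(** A mean value inequality on one side only, as it is also used for functions
    that are differentiable on the positive half-line only. *)
Lemma mvt_le (g dg : R -> R) K a b : a <= b ->
  (forall t, a <= t <= b -> is_derive t 1 g (dg t)) ->
  (forall t, a <= t <= b -> `|dg t| <= K) -> `|g b - g a| <= K * (b - a).
Proof.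
move=> ab dgP gK.
have [||c cab ->] := @MVT_segment R g dg a b ab.
- by move=> x; rewrite in_itv/= => /andP[/ltW ax /ltW xb]; apply: dgP; rewrite ax.
- apply: derivable_within_continuous => x; rewrite in_itv/= => xab.
  by have := dgP _ xab => -[dx _].
rewrite normrM (ger0_norm (_ : 0 <= b - a)) ?subr_ge0// ler_wpM2r ?subr_ge0//.
by apply: gK; rewrite in_itv/= in cab.
Qed.

Lemma mvt_le0 (g dg : R -> R) K h :
  g 0 = 0 -> (forall t, is_derive t 1 g (dg t)) ->
  (forall t, `|t| <= `|h| -> `|dg t| <= K) -> `|g h| <= K * `|h|.
Proof.
move=> g0 dgP gK; have [h0|h0] := leP 0 h.
- have := @mvt_le g dg K 0 h h0; rewrite g0 !subr0 (ger0_norm h0); apply => //.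
  by move=> t /andP[t0 th]; apply: gK; rewrite !ger0_norm.
- have := @mvt_le g dg K h 0 (ltW h0); rewrite g0 !sub0r normrN.
  rewrite (ltr0_norm h0); apply => //.
  by move=> t /andP[th t0]; apply: gK; rewrite (ltr0_norm h0) ler0_norm// lerN2.
Qed.

Lemma Phi_lip (x y : R) : `|Phi x - Phi y| <= `|x - y|.
Proof.
have := @mvt_le0 (fun t => Phi (y + t) - Phi y) (fun t => phi (y + t)) 1 (x - y).
rewrite addr0 subrr mul1r (_ : y + (x - y) = x); last by ring.
apply => //.
- move=> t.
  have h1 : is_derive t 1 (fun t => y + t) 1.
    by have := is_deriveD (is_derive_cst y t 1) (is_derive_id t (1 : R)); rewrite add0r.
  have := @is_derive1_comp R Phi (fun t => y + t) t _ _ (is_derive_Phi (y + t)) h1.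
  rewrite mulr1 => ?; apply: is_derive_eq; first exact: subr0.
- by move=> t _; rewrite ger0_norm ?phi_ge0// phi_le1.
Qed.

Lemma continuous_Phi : continuous (@Phi R).
Proof.
by move=> x; apply/differentiable_continuous/derivable1_diffP; case: (is_derive_Phi x).
Qed.

(** Three applications of the mean value inequality, each gaining one power of
    [h]; the constant is not the optimal one. *)
Lemma taylor2_le (f f1 f2 f3 : R -> R) M x h :
  (forall t, is_derive t 1 f (f1 t)) -> (forall t, is_derive t 1 f1 (f2 t)) ->
  (forall t, is_derive t 1 f2 (f3 t)) -> (forall t, `|f3 t| <= M) ->
  `|f (x + h) - f x - h * f1 x - h ^+ 2 / 2 * f2 x| <= M * `|h| ^+ 3.
Proof.
move=> d1 d2 d3 f3M.
have dsh (g dg : R -> R) : (forall t, is_derive t 1 g (dg t)) ->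
    forall t, is_derive t 1 (fun t => g (x + t)) (dg (x + t)).
  move=> dgP t.
  have hsh : is_derive t 1 (fun t => x + t) 1.
    have := is_deriveD (is_derive_cst x t 1) (is_derive_id t (1 : R)).
    by rewrite add0r.
  have := @is_derive1_comp R g (fun t => x + t) t _ _ (dgP (x + t)) hsh.
  by rewrite mulr1.
have b2 t : `|f2 (x + t) - f2 x| <= M * `|t|.
  apply: (@mvt_le0 (fun t => f2 (x + t) - f2 x) (fun t => f3 (x + t))) => //.
    by rewrite addr0 subrr.
  move=> u; have := dsh _ _ d3 u => ?; apply: is_derive_eq; first exact: subr0.
have b1 t : `|f1 (x + t) - f1 x - t * f2 x| <= M * `|t| * `|t|.
  apply: (@mvt_le0 (fun t => f1 (x + t) - f1 x - t * f2 x)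
    (fun t => f2 (x + t) - f2 x)).
  - by rewrite addr0 subrr mul0r subrr.
  - move=> u; have := dsh _ _ d2 u => ?; apply: is_derive_eq.
    by rewrite /GRing.scale/= !(mulr0, subr0, mulr1, add0r).
  - move=> u ut; apply: (le_trans (b2 u)); rewrite ler_wpM2l//.
    exact: le_trans (f3M 0).
have -> : M * `|h| ^+ 3 = M * `|h| * `|h| * `|h| by ring.
apply: (@mvt_le0 (fun h => f (x + h) - f x - h * f1 x - h ^+ 2 / 2 * f2 x)
    (fun t => f1 (x + t) - f1 x - t * f2 x)).
- by rewrite addr0 subrr; ring.
- move=> u; have := dsh _ _ d1 u => ?; apply: is_derive_eq.
  by rewrite /GRing.scale/= ; field.
- move=> u ut; apply: (le_trans (b1 u)).
  have M0 : 0 <= M by exact: le_trans (f3M 0).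
  by rewrite ler_pM// ?mulr_ge0// ler_wpM2l.
Qed.

Definition dphi x : R := - x * phi x.

Definition ddphi x : R := (x ^+ 2 - 1) * phi x.

Lemma is_derive_dphi x : is_derive x 1 dphi (ddphi x).
Proof.
have hp := is_derive_phi x.
by apply: is_derive_eq; rewrite /GRing.scale/= /ddphi; ring.
Qed.

Lemma ddphi_le x : `|ddphi x| <= 3.
Proof.
have := sqr_phi_le x; have := phi_ge0 x; have := phi_le1 x.
have : 0 <= x ^+ 2 * phi x by rewrite mulr_ge0 ?sqr_ge0 ?phi_ge0.
rewrite /ddphi mulrBl mul1r ler_norml; set y := x ^+ 2 * phi x; set u := phi x.
by move=> *; apply/andP; split; lra.
Qed.

Lemma dphi_le x : `|dphi x| <= 3.
Proof.
have := sqr_phi_le x; have := phi_ge0 x; have := phi_le1 x.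
rewrite /dphi normrM normrN (ger0_norm (phi_ge0 x)).
have : `|x| <= 1 + x ^+ 2.
  by rewrite -(real_normK (num_real x)); set y := `|x|; nra.
set y := x ^+ 2; set u := phi x => h u1 u0 h1.
have := ler_wpM2r u0 h; rewrite mulrDl mul1r; lra.
Qed.

Lemma dphi_ddphi_le x : `|2 * dphi x + x * ddphi x| <= 27.
Proof.
have -> : 2 * dphi x + x * ddphi x = 3 * dphi x + x ^+ 3 * phi x.
  by rewrite /dphi /ddphi; ring.
apply: (le_trans (ler_normD _ _)); rewrite (normrM 3) (normrM (x ^+ 3)) normrX.
rewrite (ger0_norm (phi_ge0 x)) (ger0_norm (ler0n _ 3)).
have : `|x| ^+ 3 <= x ^+ 2 + x ^+ 4.
  have -> : x ^+ 4 = (x ^+ 2) ^+ 2 by ring.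
  rewrite -(real_normK (num_real x)); set y := `|x|.
  have : 0 <= y by exact: normr_ge0. nra.
have := sqr_phi_le x; have := quad_phi_le x; have := dphi_le x.
have u0 := phi_ge0 x.
set u := phi x; set y := x ^+ 2; set w := x ^+ 4; set v := `|x| ^+ 3.
by move=> h1 h2 h3 h4; have := ler_wpM2r u0 h4; rewrite mulrDl -/u; lra.
Qed.

(** Derivatives with respect to the standard deviation rather than the variance
    avoid square roots. *)
Lemma is_derive_scale (f df : R -> R) z t : t != 0 ->
  (forall x, is_derive x 1 f (df x)) ->
  is_derive t 1 (fun t => f (z / t)) (- z / t ^+ 2 * df (z / t)).
Proof.
move=> t0 fP.
have h : is_derive t 1 (fun t => z / t) (- z / t ^+ 2).
  have hv := @is_deriveV R id t 1 1 t0 (is_derive_id _ _).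
  by apply: is_derive_eq; rewrite /GRing.scale/=; field.
have := @is_derive1_comp R f (fun t => z / t) t _ _ (fP (z / t)) h.
by rewrite mulrC.
Qed.

(** The heat equation in integrated form.  With [L t] the second derivative in
    [z] of [Phi (z / t)], the derivative in [t] of [Phi (z / t)] is [t * L t],
    and [L] is Lipschitz away from 0. *)
Lemma heat_le z c s s' : 0 < s -> 0 < s' -> s' ^+ 2 = s ^+ 2 + c ^+ 2 ->
  `|c| <= s ->
  `|Phi (z / s') - Phi (z / s) - (c / s) ^+ 2 / 2 * dphi (z / s)| <=
    54 * `|c / s| ^+ 3.
Proof.
move=> s0 s'0 s'E cs.
have ss' : s <= s'.
  by rewrite -(ler_pXn2r (ltn0Sn 1)) ?nnegrE; [rewrite s'E lerDl sqr_ge0|exact: ltW..].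
pose L t := dphi (z / t) / t ^+ 2.
have LP t : t != 0 ->
    is_derive t 1 L (- (2 * dphi (z / t) + (z / t) * ddphi (z / t)) / t ^+ 3).
  move=> t0; have h1 := is_derive_scale z t0 is_derive_dphi.
  have t20 : t ^+ 2 != 0 by rewrite expf_neq0.
  have h2 : is_derive t 1 (fun t => t ^+ 2) (2 * t).
    by apply: is_derive_eq; rewrite /GRing.scale/=; ring.
  have h3 := @is_deriveV R (fun t => t ^+ 2) t _ 1 t20 h2.
  by rewrite /L; apply: is_derive_eq; rewrite /GRing.scale/=; field.
have bL t : s <= t -> `|L t - L s| <= 27 / s ^+ 3 * (t - s).
  move=> st; apply: (mvt_le st) => [u /andP[su _]|u /andP[su _]].
    by apply: LP; rewrite gt_eqF// (lt_le_trans s0).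
  have u0 : 0 < u by exact: lt_le_trans su.
  rewrite normrM normrN normfV normrX (gtr0_norm u0) ler_pM//.
  - by rewrite invr_ge0 exprn_ge0// ltW.
  - exact: dphi_ddphi_le.
  - by rewrite lef_pV2 ?posrE ?exprn_gt0// lerXn2r ?nnegrE// ltW.
have := @mvt_le (fun t => Phi (z / t) - (t ^+ 2 - s ^+ 2) / 2 * L s)
  (fun t => t * (L t - L s)) (s' * (27 / s ^+ 3 * (s' - s))) s s' ss'.
have -> : Phi (z / s') - (s' ^+ 2 - s ^+ 2) / 2 * L s -
    (Phi (z / s) - (s ^+ 2 - s ^+ 2) / 2 * L s) =
    Phi (z / s') - Phi (z / s) - (c / s) ^+ 2 / 2 * dphi (z / s).
  by rewrite s'E /L; field; rewrite gt_eqF.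
move=> h; apply: (le_trans (h _ _)) => {h}.
- move=> t /andP[st ts]; have t0 : t != 0 by rewrite gt_eqF// (lt_le_trans s0).
  have h1 := is_derive_scale z t0 is_derive_Phi.
  by apply: is_derive_eq; rewrite /GRing.scale/= /L /dphi; field; rewrite t0 gt_eqF.
- move=> t /andP[st ts]; rewrite normrM ler_pM//.
    by rewrite ger0_norm// (le_trans (ltW s0)).
  apply: (le_trans (bL _ st)); rewrite ler_wpM2l ?lerB//.
  by rewrite divr_ge0// exprn_ge0// ltW.
set u := `|c / s|.
have uE : u = `|c| / s by rewrite /u normrM normfV (gtr0_norm s0).
have u0 : 0 <= u by exact: normr_ge0.
have u1 : u <= 1 by rewrite uE ler_pdivrMr// mul1r.
have cE : c ^+ 2 = (u * s) ^+ 2.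
  by rewrite uE divfK ?gt_eqF// real_normK// num_real.
rewrite cE in s'E.
pose w := s' / s.
have wE : s' = w * s by rewrite /w divfK ?gt_eqF.
have w1 : 1 <= w by rewrite /w ler_pdivlMr// mul1r.
have wu : w ^+ 2 = 1 + u ^+ 2.
  rewrite /w expr_div_n s'E; field; by rewrite gt_eqF.
rewrite wE.
have -> : w * s * (27 / s ^+ 3 * (w * s - s)) * (w * s - s) = 27 * w * (w - 1) ^+ 2.
  by field; rewrite gt_eqF.
have -> : 54 * u ^+ 3 = 27 * 2 * (u * u ^+ 2) by ring.
have h1 : w - 1 <= u ^+ 2 by nra.
have h2 : w <= 2 by nra.
have h3 : (w - 1) ^+ 2 <= u * u ^+ 2.
  have -> : (w - 1) ^+ 2 = (w - 1) * (w - 1) by ring.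
  apply: ler_pM; rewrite ?subr_ge0//; nra.
by apply: ler_pM; rewrite ?sqr_ge0//; lra.
Qed.

(** One step of the chain takes the values [1] and [-1] with mean [h], so its
    centred version takes the values [1 - h] and [-1 - h] and has variance
    [1 - h ^+ 2].  Averaging [Phi (_ / s)] over it acts, up to a cubic error and
    the defect [h ^+ 2] of the variance, like adding [c ^+ 2] to the variance
    [s ^+ 2]. *)
Lemma heat_step z c s s' h : 0 < s -> 0 < s' -> s' ^+ 2 = s ^+ 2 + c ^+ 2 ->
  `|c| <= s -> `|h| <= 1 ->
  `|(1 + h) / 2 * Phi ((z - c * (1 - h)) / s) +
    (1 - h) / 2 * Phi ((z - c * (-1 - h)) / s) - Phi (z / s')| <=
    2 * (c / s) ^+ 2 * h ^+ 2 + 78 * `|c / s| ^+ 3.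
Proof.
move=> s0 s'0 s'E cs h1.
have sn0 : s != 0 by rewrite gt_eqF.
have hE := heat_le z s0 s'0 s'E cs.
have -> : (z - c * (1 - h)) / s = z / s + - (c / s) * (1 - h) by field.
have -> : (z - c * (-1 - h)) / s = z / s + c / s * (1 + h) by field.
move: (Phi (z / s')) hE; move: (z / s) (c / s) => x u P' hE.
have T y : `|Phi (x + y) - Phi x - y * phi x - y ^+ 2 / 2 * dphi x| <= 3 * `|y| ^+ 3.
  apply: (@taylor2_le Phi phi dphi ddphi).
  - exact: is_derive_Phi.
  - exact: is_derive_phi.
  - exact: is_derive_dphi.
  - exact: ddphi_le.
move: h1; rewrite ler_norml => /andP[hl hr].
have hm : 0 <= 1 - h by lra.
have hp : 0 <= 1 + h by lra.
have hm2 : `|- u * (1 - h)| ^+ 3 <= `|u| ^+ 3 * 8.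
  rewrite normrM normrN exprMn (ger0_norm hm) ler_wpM2l ?exprn_ge0//.
  by rewrite [leRHS](_ : _ = 2 ^+ 3); [rewrite lerXn2r ?nnegrE//; lra|ring].
have hp2 : `|u * (1 + h)| ^+ 3 <= `|u| ^+ 3 * 8.
  rewrite normrM exprMn (ger0_norm hp) ler_wpM2l ?exprn_ge0//.
  by rewrite [leRHS](_ : _ = 2 ^+ 3); [rewrite lerXn2r ?nnegrE//; lra|ring].
have hA := T (- u * (1 - h)); have hB := T (u * (1 + h)).
have v0 : 0 <= `|u| ^+ 3 by rewrite exprn_ge0.
have hk := dphi_le x.
move: ((`|u| ^+ 3) : R) v0 hm2 hp2 hE => v v0 hm2 hp2 hE.
move: (Phi x) (phi x) (dphi x) hk hE hA hB => P q k hk hE.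
move: (Phi (x + - u * (1 - h))) (Phi (x + u * (1 + h))) => A B hA hB.
have {hm2}hA : `|A - P - - u * (1 - h) * q - (- u * (1 - h)) ^+ 2 / 2 * k| <= 24 * v.
  by apply: (le_trans hA); lra.
have {hp2}hB : `|B - P - u * (1 + h) * q - (u * (1 + h)) ^+ 2 / 2 * k| <= 24 * v.
  by apply: (le_trans hB); lra.
set EA := _ - _ in hA; set EB := _ - _ in hB; set EH := _ - _ in hE.
have -> : (1 + h) / 2 * A + (1 - h) / 2 * B - P' =
   (1 + h) / 2 * EA + (1 - h) / 2 * EB - EH - u ^+ 2 * h ^+ 2 / 2 * k.
  by rewrite /EA /EB /EH; field.
have hk2 : u ^+ 2 * h ^+ 2 / 2 * `|k| <= u ^+ 2 * h ^+ 2 / 2 * 3.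
  by rewrite ler_wpM2l// divr_ge0// mulr_ge0// sqr_ge0.
have w0 : 0 <= u ^+ 2 * h ^+ 2 by rewrite mulr_ge0// sqr_ge0.
apply: (le_trans (ler_normB _ _)).
rewrite (normrM (u ^+ 2 * h ^+ 2 / 2)) (ger0_norm (_ : 0 <= u ^+ 2 * h ^+ 2 / 2)); last by lra.
apply: (le_trans (lerD (ler_normB _ _) hk2)).
have hAB : `|(1 + h) / 2 * EA + (1 - h) / 2 * EB| <= 24 * v.
  apply: (le_trans (ler_normD _ _)); rewrite !normrM.
  rewrite (ger0_norm hm) (ger0_norm hp) (ger0_norm (_ : 0 <= 2^-1)) ?invr_ge0//.
  have := ler_wpM2l hp hA; have := ler_wpM2l hm hB.
  move: (`|EA|) (`|EB|) => ? ? ? ?; nra.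
rewrite -(mulrA 2); move: (u ^+ 2 * h ^+ 2) w0 => w w0; lra.
Qed.

End heat_step.

(** * Linear recurrences with slowly varying coefficients *)

Section recurrence.
Context {R : realType}.
Implicit Types (y g r w b : nat -> R) (lambda : R).

Lemma cvg_seq_continuous (f : nat -> R) (g : R -> R) (l : R) :
  f n @[n --> \oo] --> l -> {for l, continuous g} ->
  g (f n) @[n --> \oo] --> g l.
Proof. by move=> fl gl; apply: (@cvg_comp _ _ _ f g \oo _ _ fl gl). Qed.

Lemma cvg_from_diff (f g h : nat -> R) (l : R) :
  f n - g n @[n --> \oo] --> (0 : R) -> h n @[n --> \oo] --> l ->
  (\forall n \near \oo, h n = g n) -> f n @[n --> \oo] --> l.
Proof.
move=> fg hl hg; have fhl : (f n - g n) + h n @[n --> \oo] --> l.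
  by rewrite -[X in _ --> X]add0r; apply: cvgD.
apply: cvg_trans fhl; apply: near_eq_cvg.
by apply: filterS hg => n ->; rewrite subrK.
Qed.

(** Discrete Gronwall argument: [w] is a strict supersolution of the homogeneous
    recurrence and absorbs the source [g], while [b] is a supersolution that
    absorbs the value from which the comparison starts and is negligible with
    respect to [w]. *)
Lemma rec_small y g r w b lambda :
  (forall n, 0 <= r n) -> (forall n, y n.+1 = r n * y n + g n) ->
  g n @[n --> \oo] --> (0 : R) ->
  0 < lambda -> w n.+1 - r n * w n @[n --> \oo] --> lambda ->
  (forall n, 0 < b n) -> (forall n, r n * b n <= b n.+1) ->
  (\forall n \near \oo, 0 < w n) -> b n / w n @[n --> \oo] --> (0 : R) ->
  y n / w n @[n --> \oo] --> (0 : R).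
Proof.
move=> r0 yE g0 l0 wl b0 bS wpos bw; apply/cvgr0Pnorm_le => eta eta0.
have [N _ HN] : \forall n \near \oo, [/\ `|g n| <= eta * lambda / 4,
    lambda / 2 <= w n.+1 - r n * w n & 0 < w n].
  have h1 : \forall n \near \oo, `|g n| <= eta * lambda / 4.
    by move/cvgr0Pnorm_le : g0; apply; rewrite divr_gt0// mulr_gt0.
  have h2 : \forall n \near \oo, lambda / 2 <= w n.+1 - r n * w n.
    by move/cvgr_ge : wl; apply; lra.
  by near=> n; split; near: n.
pose C := `|y N| / b N.
have C0 : 0 <= C by rewrite divr_ge0// ltW.
have key n : (N <= n)%N -> `|y n| <= eta / 2 * w n + C * b n.
  elim: n => [|n IH]; rewrite leq_eqVlt => /predU1P[<-|].
  - rewrite /C divfK ?gt_eqF// lerDr mulr_ge0 ?divr_ge0// ltW//.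
    by have [] := HN N (leqnn _).
  - by rewrite ltn0.
  - rewrite /C divfK ?gt_eqF// lerDr mulr_ge0 ?divr_ge0// ltW//.
    by have [] := HN N (leqnn _).
  - rewrite ltnS => Nn; have [gn wn _] := HN n Nn.
    rewrite yE; apply: (le_trans (ler_normD _ _)).
    rewrite normrM (ger0_norm (r0 n)).
    have := ler_wpM2l (r0 n) (IH Nn); have := ler_wpM2l C0 (bS n).
    have := ler_wpM2l (ltW eta0) wn.
    move: gn; set G := `|g n|; set Y := `|y n|.
    lra.
have : \forall n \near \oo, C * `|b n / w n| <= eta / 2.
  have : (C * (b n / w n)) @[n --> \oo] --> (0 : R).
    by rewrite -[X in _ --> X](mulr0 C); apply: cvgMl_tmp.
  move/cvgr0Pnorm_le => /(_ (eta / 2)); rewrite divr_gt0// => /(_ isT).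
  by apply: filterS => n; rewrite normrM ger0_norm.
move=> hb; near=> n.
have wn : 0 < w n by near: n.
have Nn : (N <= n)%N by near: n; exact: nbhs_infty_ge.
have bn : C * `|b n / w n| <= eta / 2 by near: n.
rewrite normrM normfV (gtr0_norm wn) ler_pdivrMr//.
apply: (le_trans (key _ Nn)).
have q0 : 0 <= b n / w n by rewrite divr_ge0// ltW.
by move: bn; rewrite (ger0_norm q0) mulrA ler_pdivrMr//; lra.
Unshelve. all: by end_near. Qed.

(** Unrolled, this is the sum over [1 <= k <= n] of [g k] times the product over
    [k < j <= n] of [(1 + a / j) ^+ 2]. *)
Fixpoint rec_sum (a : R) g n : R :=
  if n is n'.+1 then (1 + a / n%:R) ^+ 2 * rec_sum a g n' + g n else 0.

Lemma rec_sum_ge0 a g n : (forall k, 0 <= g k) -> 0 <= rec_sum a g n.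
Proof.
move=> g0; elim: n => //= n IH; by rewrite addr_ge0// mulr_ge0// sqr_ge0.
Qed.

(** [w n] is the squared order of magnitude of the walk at time [n.+1]; the
    function [b] bounds the square of the weight of any single step. *)
Record scaling (a : R) (w : nat -> R) (lambda : R) (b : nat -> R) : Prop := Scaling {
  scaling_lambda : 0 < lambda ;
  scaling_w : w n.+1 - (1 + a / n.+1%:R) ^+ 2 * w n @[n --> \oo] --> lambda ;
  scaling_b1 : forall n, 1 <= b n ;
  scaling_bS : forall n, (1 + a / n.+1%:R) ^+ 2 * b n <= b n.+1 ;
  scaling_w0 : \forall n \near \oo, 0 < w n ;
  scaling_bw : b n / w n @[n --> \oo] --> (0 : R) }.

Lemma rec_sum_small a w lambda b g : scaling a w lambda b ->
  g n @[n --> \oo] --> (0 : R) -> rec_sum a g n / w n @[n --> \oo] --> (0 : R).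
Proof.
move=> S g0; have [l0 wl b1 bS w0 bw] := S.
apply: (rec_small (r := fun n => (1 + a / n.+1%:R) ^+ 2) (g := fun n => g n.+1)
  (b := b) (lambda := lambda)) => //.
- by move=> n; exact: sqr_ge0.
- by rewrite cvg_shiftS.
- by move=> n; exact: lt_le_trans (b1 n).
Qed.

(** [rec_sum a 1 - w / lambda] solves the same recurrence with a source that
    tends to 0. *)
Lemma rec_sum1_cvg a w lambda b : scaling a w lambda b ->
  rec_sum a (fun=> 1) n / w n @[n --> \oo] --> lambda^-1.
Proof.
move=> S; have [l0 wl b1 bS w0 bw] := S.
pose y n := rec_sum a (fun=> 1) n - w n / lambda.
have y0 : y n / w n @[n --> \oo] --> (0 : R).
  apply: (rec_small (r := fun n => (1 + a / n.+1%:R) ^+ 2) (b := b)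
    (g := fun n => 1 - (w n.+1 - (1 + a / n.+1%:R) ^+ 2 * w n) / lambda)
    (lambda := lambda)) => //.
  - by move=> n; exact: sqr_ge0.
  - by move=> n; rewrite /y /=; field; rewrite gt_eqF//= pnatr_eq0.
  - rewrite -[X in _ --> X](subrr 1); apply: cvgB; first exact: cvg_cst.
    rewrite -[X in _ --> X](divff (lt0r_neq0 l0)).
    by apply: cvgM => //; exact: cvg_cst.
  - by move=> n; exact: lt_le_trans (b1 n).
have : y n / w n + lambda^-1 @[n --> \oo] --> lambda^-1.
  by rewrite -[X in _ --> X]add0r; apply: cvgD => //; exact: cvg_cst.
apply: cvg_trans; apply: near_eq_cvg; near=> n.
have wn : 0 < w n by near: n.
by rewrite /y; field; rewrite !gt_eqF.
Unshelve. all: by end_near. Qed.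

End recurrence.

(** * The diffusive and critical scalings *)

Section scalings.
Context {R : realType}.
Implicit Types (a : R).

Lemma cvg_invS : (n.+1%:R : R)^-1 @[n --> \oo] --> (0 : R).
Proof. exact: cvg_harmonic. Qed.

Lemma ln_nat_cvgy : (ln (n.+1%:R : R)) @[n --> \oo] --> +oo.
Proof.
apply/cvgryPge => A; near=> n.
rewrite -ler_expR lnK ?posrE//.
apply: (@le_trans _ _ n%:R); last by rewrite ler_nat.
by near: n; exact: nbhs_infty_ger.
Unshelve. all: by end_near. Qed.

Lemma ln_nat_ge0 n : 0 <= ln (n.+1%:R : R).
Proof. by rewrite ln_ge0// ler1n. Qed.

(** For every [eta > 0], [ln x <= eta * x + C] by sublinearity of the logarithm
    at [eta * x]. *)
Lemma ln_nat_small : ln (n.+1%:R : R) / n.+1%:R @[n --> \oo] --> (0 : R).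
Proof.
apply/cvgr0Pnorm_le => eta eta0.
have e20 : 0 < eta / 2 by rewrite divr_gt0.
pose C : R := `|ln (eta / 2)|.
have C0 : 0 <= C by exact: normr_ge0.
have : C * (n.+1%:R)^-1 @[n --> \oo] --> (0 : R).
  by rewrite -[X in _ --> X](mulr0 C); apply: cvgM; [exact: cvg_cst|exact: cvg_invS].
move/cvgr0Pnorm_le => /(_ _ e20) h; near=> n.
have hn : `|C / n.+1%:R| <= eta / 2 by near: n.
have n0 : 0 < n.+1%:R :> R by rewrite ltr0n.
rewrite ger0_norm ?divr_ge0 ?ln_nat_ge0//.
have q0 : 0 <= C / n.+1%:R by rewrite divr_ge0.
rewrite (ger0_norm q0) ler_pdivrMr// in hn.
rewrite ler_pdivrMr//.
have := @ln_sublinear R (eta / 2 * n.+1%:R).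
rewrite mulr_gt0// lnM ?posrE// => /(_ isT).
have : - ln (eta / 2) <= C by rewrite /C lerNl lerNnormlW.
by lra.
Unshelve. all: by end_near. Qed.

Definition harm n : R := \sum_(k < n) (k.+1%:R)^-1.

Lemma harmS n : harm n.+1 = harm n + (n.+1%:R)^-1.
Proof. by rewrite /harm big_ord_recr. Qed.

Lemma harm_ge0 n : 0 <= harm n.
Proof. by rewrite sumr_ge0. Qed.

(** Comparison of [1 / (n + 2)] with the increment of the logarithm. *)
Lemma harm_le n : harm n.+1 <= 1 + ln n.+1%:R.
Proof.
elim: n => [|n IH]; first by rewrite harmS /harm big_ord0 add0r invr1 ln1 addr0.
rewrite harmS.
have n0 : 0 < n.+1%:R :> R by rewrite ltr0n.
have n1 : 0 < n.+2%:R :> R by rewrite ltr0n.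
have := @le_ln1Dx R (- (n.+2%:R)^-1).
have -> : 1 - (n.+2%:R)^-1 = n.+1%:R / n.+2%:R :> R.
  by rewrite -[n.+2%:R]natr1; field; rewrite ?natr1 ?pnatr_eq0.
rewrite ln_div ?posrE// ltrN2 invf_lt1// ltr1n => /(_ isT).
move: (ln n.+1%:R) (ln n.+2%:R) (n.+2%:R^-1) (harm n.+1) IH => x y z u; lra.
Qed.

Lemma harm_small : harm n.+1 / n.+1%:R @[n --> \oo] --> (0 : R).
Proof.
apply: (@squeeze_cvgr _ _ _ _ (fun=> 0)
  (fun n => (n.+1%:R)^-1 + ln n.+1%:R / n.+1%:R)).
- near=> n; rewrite divr_ge0 ?harm_ge0//= -[X in X + _]mul1r -mulrDl.
  by rewrite ler_wpM2r ?harm_le.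
- exact: cvg_cst.
- rewrite -[X in _ --> X](addr0 0); apply: cvgD; first exact: cvg_invS.
  exact: ln_nat_small.
Unshelve. all: by end_near. Qed.

(** The weights are dominated by the exponential of a multiple of the harmonic
    sum, that is by a power of [n] smaller than the first one. *)
Lemma scaling_diffusive a : -1 < a -> a < 1 / 2 ->
  exists b, scaling a (fun n => n.+1%:R) (1 - 2 * a) b.
Proof.
move=> a1 a2; pose c := Num.max a 0.
have c0 : 0 <= c by rewrite le_max lexx orbT.
have ac : a <= c by rewrite le_max lexx.
have c2 : c < 1 / 2 by rewrite gt_max a2; lra.
exists (fun n => expR (2 * c * harm n)); split.
- lra.
- have -> : (fun n => n.+2%:R - (1 + a / n.+1%:R) ^+ 2 * n.+1%:R) =
      (fun n => 1 - 2 * a - a ^+ 2 * (n.+1%:R)^-1).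
    by apply/funext => n; rewrite -[n.+2%:R]natr1; field; rewrite ?natr1 ?pnatr_eq0.
  rewrite -[X in _ --> X]subr0; apply: cvgB; first exact: cvg_cst.
  rewrite -[X in _ --> X](mulr0 (a ^+ 2)); apply: cvgM; first exact: cvg_cst.
  exact: cvg_invS.
- by move=> n; rewrite -expR0 ler_expR !mulr_ge0// harm_ge0.
- move=> n; rewrite harmS mulrDr expRD mulrC ler_wpM2l ?expR_ge0//.
  have n0 : 0 < (n.+1%:R)^-1 :> R by rewrite invr_gt0.
  have n1 : (n.+1%:R)^-1 <= 1 :> R by rewrite invf_le1// ler1n.
  have := expR_ge1Dx (c * (n.+1%:R)^-1).
  have -> : 2 * c / n.+1%:R = c / n.+1%:R + c / n.+1%:R by ring.
  rewrite expRD; set e := expR _; set x : R := (n.+1%:R)^-1 in n0 n1 *.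
  move=> he; rewrite expr2; apply: ler_pM; nra.
- by near=> n.
- apply: (@squeeze_cvgr _ _ _ _ (fun=> 0)
    (fun n => expR (2 * c) * expR (- ((1 - 2 * c) * ln n.+1%:R)))).
  + near=> n; rewrite divr_ge0 ?expR_ge0//=.
    have n0 : 0 < n.+1%:R :> R by rewrite ltr0n.
    rewrite -[X in _ / X]lnK ?posrE// -expRN -!expRD ler_expR.
    have h : harm n <= 1 + ln n.+1%:R.
      by apply: le_trans (harm_le n); rewrite harmS lerDl invr_ge0.
    have := ler_wpM2l c0 h; lra.
  + exact: cvg_cst.
  + rewrite -[X in _ --> X](mulr0 (expR (2 * c))); apply: cvgM; first exact: cvg_cst.
    apply: (@cvg_comp _ _ _ (fun n => ln n.+1%:R)
      (fun x : R => expR (- ((1 - 2 * c) * x))) _ +oo); first exact: ln_nat_cvgy.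
    apply: (@cvg_comp _ _ _ (fun x => (1 - 2 * c) * x)
      (fun x : R => expR (- x)) _ +oo); last exact: cvgr_expR.
    by apply: gt0_cvgMry; [lra|exact: cvg_id].
Unshelve. all: by end_near. Qed.

Lemma scaling_critical :
  scaling (1 / 2 : R) (fun n => n.+1%:R * ln n.+1%:R) 1 (fun n => 2 * n.+1%:R - 1 / 2).
Proof.
split.
- exact: ltr01.
- have -> : (fun n => n.+2%:R * ln n.+2%:R -
        (1 + 1 / 2 / n.+1%:R) ^+ 2 * (n.+1%:R * ln n.+1%:R)) =
      (fun n => n.+2%:R * (ln n.+2%:R - ln n.+1%:R) - 1 / 4 * (ln n.+1%:R / n.+1%:R)) :> (nat -> R).
    by apply/funext => n; rewrite -[n.+2%:R]natr1; field; rewrite ?natr1 ?pnatr_eq0.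
  rewrite -[X in _ --> X]subr0; apply: cvgB; last first.
    rewrite -[X in _ --> X](mulr0 (1 / 4)); apply: cvgM; first exact: cvg_cst.
    exact: ln_nat_small.
  apply: (@squeeze_cvgr _ _ _ _ (fun=> 1) (fun n => 1 + (n.+1%:R)^-1)).
  + near=> n.
    have n0 : 0 < n.+1%:R :> R by rewrite ltr0n.
    have n1 : 0 < n.+2%:R :> R by rewrite ltr0n.
    have h1 := @le_ln1Dx R (- (n.+2%:R)^-1).
    have h2 := @le_ln1Dx R ((n.+1%:R)^-1).
    have e1 : 1 - (n.+2%:R)^-1 = n.+1%:R / n.+2%:R :> R.
      by rewrite -[n.+2%:R]natr1; field; rewrite ?natr1 ?pnatr_eq0.
    have e2 : 1 + (n.+1%:R)^-1 = n.+2%:R / n.+1%:R :> R.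
      by rewrite -[n.+2%:R]natr1; field; rewrite ?natr1 ?pnatr_eq0.
    rewrite e1 ln_div ?posrE// ltrN2 invf_lt1// ltr1n in h1.
    rewrite e2 ln_div ?posrE// in h2.
    have {}h1 := h1 isT.
    have {}h2 : ln n.+2%:R - ln n.+1%:R <= n.+1%:R^-1 :> R.
      by apply: h2; rewrite (lt_trans (ltrN10 _))// invr_gt0.
    rewrite e2; apply/andP; split.
      by rewrite -ler_pdivrMl// mulr1 -lerN2 opprB.
    by rewrite ler_wpM2l// ler0n.
  + exact: cvg_cst.
  + rewrite -[X in _ --> X](addr0 1); apply: cvgD; [exact: cvg_cst|exact: cvg_invS].
- move=> n; have : 1 <= n.+1%:R :> R by rewrite ler1n. lra.
- move=> n; rewrite -[n.+2%:R]natr1.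
  have : 1 <= n.+1%:R :> R by rewrite ler1n.
  move: (n.+1%:R : R) => k k1.
  have k0 : 0 < k by lra.
  have -> : (1 + 1 / 2 / k) ^+ 2 * (2 * k - 1 / 2) =
     2 * (k + 1) - 1 / 2 - k ^- 2 / 8 by field; rewrite gt_eqF.
  by rewrite gerBl divr_ge0// invr_ge0 sqr_ge0.
- near=> n; rewrite mulr_gt0// ln_gt0// ltr1n ltnS.
  by near: n; exact: nbhs_infty_gt.
- apply: (@squeeze_cvgr _ _ _ _ (fun=> 0) (fun n => 2 * (ln n.+1%:R)^-1)).
  + near=> n.
    have n1 : 1 < n.+1%:R :> R.
      by rewrite ltr1n ltnS; near: n; exact: nbhs_infty_gt.
    have l0 : 0 < ln n.+1%:R :> R by rewrite ln_gt0.
    have n0 : 0 < n.+1%:R :> R by rewrite ltr0n.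
    rewrite divr_ge0 ?mulr_ge0 ?(ltW l0)//=; last lra.
    rewrite ler_pdivrMr ?mulr_gt0// [leRHS](_ : _ = 2 * n.+1%:R); first lra.
    by field; rewrite gt_eqF.
  + exact: cvg_cst.
  + rewrite -[X in _ --> X](mulr0 2); apply: cvgM; first exact: cvg_cst.
    apply/gtr0_cvgV0; last exact: ln_nat_cvgy.
    by near=> n; rewrite ln_gt0// ltr1n ltnS; near: n; exact: nbhs_infty_gt.
Unshelve. all: by end_near. Qed.

End scalings.

(** * The elephant random walk as a Markov chain *)

Section erw_mean.
Context {R : realType}.
Implicit Types (a p : R) (f g : R -> R).

(** One step of the chain: from [x] at time [k] it moves to [x + 1] or [x - 1]
    with mean displacement [a * (x / k)]. *)
Definition erw_op a k g : R -> R := fun x =>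
  (1 + a * (x / k%:R)) / 2 * g (x + 1) + (1 - a * (x / k%:R)) / 2 * g (x - 1).

(** The expectation of [g] at the position of the full-memory walk at time
    [n.+1]; the last step is averaged first. *)
Fixpoint erw_mean p n g : R :=
  if n is n'.+1 then erw_mean p n' (erw_op (2 * p - 1) n g)
  else p * g 1 + (1 - p) * g (-1).

(** The transition weights are nonnegative on the positions that can be reached
    at time [k], which lie between [- k] and [k]. *)
Lemma erw_op_le p k f g x : 0 <= p <= 1 -> `|x| <= k%:R ->
  (forall y, `|y| <= k.+1%:R -> f y <= g y) ->
  erw_op (2 * p - 1) k f x <= erw_op (2 * p - 1) k g x.
Proof.
move=> /andP[p0 p1] xk fg.
have h1 : `|x / k%:R| <= 1.
  have [->|k0] := eqVneq k 0%N; first by rewrite invr0 mulr0 normr0.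
  rewrite normrM normfV (ger0_norm (ler0n _ _)) ler_pdivrMr ?mul1r//.
  by rewrite ltr0n lt0n.
have h2 : `|(2 * p - 1) * (x / k%:R)| <= 1.
  by rewrite normrM -[leRHS]mulr1 ler_pM// ler_norml; apply/andP; split; lra.
have x1 : `|x + 1| <= k.+1%:R.
  by rewrite (le_trans (ler_normD _ _))// normr1 -natr1 lerD2r.
have x2 : `|x - 1| <= k.+1%:R.
  by rewrite (le_trans (ler_normB _ _))// normr1 -natr1 lerD2r.
move: h2; rewrite ler_norml => /andP[h2 h3].
by rewrite /erw_op lerD// ler_wpM2l ?fg//; lra.
Qed.

Lemma erw_mean_le p n f g : 0 <= p <= 1 ->
  (forall x, `|x| <= n.+1%:R -> f x <= g x) -> erw_mean p n f <= erw_mean p n g.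
Proof.
move=> p01; elim: n f g => /= [|n IH] f g fg.
  by rewrite lerD// ler_wpM2l ?fg ?normrN ?normr1//; lra.
by apply: IH => x xn; exact: erw_op_le.
Qed.

Lemma erw_meanD p n f g :
  erw_mean p n (fun x => f x + g x) = erw_mean p n f + erw_mean p n g.
Proof.
elim: n f g => /= [|n IH] f g; first by ring.
by rewrite -IH; congr erw_mean; apply/funext => x; rewrite /erw_op; ring.
Qed.

Lemma erw_meanZ p n c f : erw_mean p n (fun x => c * f x) = c * erw_mean p n f.
Proof.
elim: n f => /= [|n IH] f; first by ring.
by rewrite -IH; congr erw_mean; apply/funext => x; rewrite /erw_op; ring.
Qed.

Lemma erw_mean_cst p n c : erw_mean p n (fun=> c) = c.
Proof.
elim: n => /= [|n IH]; first by ring.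
by rewrite -[RHS]IH; congr erw_mean; apply/funext => x; rewrite /erw_op; field.
Qed.

Lemma erw_mean_norm_le p n f g : 0 <= p <= 1 ->
  (forall x, `|x| <= n.+1%:R -> `|f x| <= g x) ->
  `|erw_mean p n f| <= erw_mean p n g.
Proof.
move=> p01 fg; rewrite ler_norml; apply/andP; split.
  rewrite -mulN1r -erw_meanZ; apply: erw_mean_le => // x /fg.
  by rewrite ler_norml mulN1r => /andP[].
by apply: erw_mean_le => // x /fg; rewrite ler_norml => /andP[].
Qed.

Lemma erw_mean_sqrS p n : 0 <= p <= 1 ->
  erw_mean p n.+1 (fun x => x ^+ 2) =
  1 + (1 + 2 * (2 * p - 1) / n.+1%:R) * erw_mean p n (fun x => x ^+ 2).
Proof.
move=> p01 /=; rewrite -erw_meanZ -[X in _ = X + _](erw_mean_cst p n 1) -erw_meanD.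
congr erw_mean; apply/funext => x; rewrite /erw_op; field.
by rewrite nat1r pnatr_eq0.
Qed.

Lemma erw_mean_sqr_ge0 p n : 0 <= p <= 1 -> 0 <= erw_mean p n (fun x => x ^+ 2).
Proof.
move=> p01; rewrite -(erw_mean_cst p n 0); apply: erw_mean_le => // x _.
exact: sqr_ge0.
Qed.

(** For [p <= 3 / 4] the second moment [e] satisfies
    [e n.+1 <= 1 + (1 + 1 / n.+1) * e n], solved by [n.+1 * harm n.+1]. *)
Lemma erw_mean_sqr_le p n : 0 <= p <= 3 / 4 ->
  erw_mean p n (fun x => x ^+ 2) <= n.+1%:R * harm n.+1.
Proof.
move=> /andP[p0 p1]; have p01 : 0 <= p <= 1 by apply/andP; split; lra.
elim: n => [|n IH].
  by rewrite /= /harm big_ord1 invr1 sqrrN !expr1n; lra.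
rewrite erw_mean_sqrS// harmS; have := erw_mean_sqr_ge0 n p01.
have -> : 2 * (2 * p - 1) / n.+1%:R = (4 * p - 2) * (n.+1%:R)^-1 by ring.
have k0 : 0 < n.+1%:R :> R by rewrite ltr0n.
have i0 : 0 < (n.+1%:R)^-1 :> R by rewrite invr_gt0.
rewrite -[n.+2%:R]natr1.
move: (erw_mean _ _ _) (harm _) IH k0 i0 => e H.
move: (n.+1%:R : R) => k IH k0 i0 e0.
have h1 : (4 * p - 2) * k^-1 * e <= k^-1 * e.
  by rewrite -mulrA ler_piMl ?mulr_ge0 ?(ltW i0)//; lra.
have h2 : k^-1 * e <= H by rewrite ler_pdivrMl.
have -> : (k + 1) * (H + (k + 1)^-1) = k * H + H + 1.
  by field; rewrite gt_eqF//; lra.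
by rewrite mulrDl mul1r; lra.
Qed.

Lemma erw_mean_sqr_small p : 0 <= p <= 3 / 4 ->
  erw_mean p n (fun x => x ^+ 2) / n.+1%:R ^+ 2 @[n --> \oo] --> (0 : R).
Proof.
move=> p34; have p01 : 0 <= p <= 1.
  by move: p34 => /andP[? ?]; apply/andP; split; lra.
apply: (@squeeze_cvgr _ _ _ _ (fun=> 0) (fun n => harm n.+1 / n.+1%:R)).
- near=> n; rewrite divr_ge0 ?erw_mean_sqr_ge0 ?sqr_ge0//=.
  rewrite expr2 invfM mulrA ler_wpM2r// ler_pdivrMr// mulrC.
  exact: erw_mean_sqr_le.
- exact: cvg_cst.
- exact: harm_small.
Unshelve. all: by end_near. Qed.

Definition mean_sqr_rate p k : R :=
  erw_mean p k.-1 (fun x => x ^+ 2) / k%:R ^+ 2.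

(** Backward induction on the heat flow: undoing the last step changes the
    coefficient [c] into [c * (1 + a / n)] and the variance [s ^+ 2] into
    [s ^+ 2 + c ^+ 2].  The errors of [heat_step] add up to the two recurrences
    [rec_sum]; the last term comes from the first step of the walk, which is
    not centred.  [M] bounds all the coefficients met on the way. *)
Lemma erw_heat_bound p (b : nat -> R) (M eps x0 : R) n (c s s' : R) :
  0 <= p <= 1 -> 0 < eps -> 0 <= M -> M <= eps ->
  (forall n, 1 <= b n) ->
  (forall n, (1 + (2 * p - 1) / n.+1%:R) ^+ 2 * b n <= b n.+1) ->
  c ^+ 2 * b n <= M ^+ 2 -> eps <= s -> 0 < s' ->
  s' ^+ 2 = s ^+ 2 + c ^+ 2 * rec_sum (2 * p - 1) (fun=> 1) n ->
  `|erw_mean p n (fun x => Phi ((x0 - c * x) / s)) - Phi (x0 / s')| <=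
    2 * (2 * p - 1) ^+ 2 / eps ^+ 2 *
      (c ^+ 2 * rec_sum (2 * p - 1) (mean_sqr_rate p) n) +
    78 * M / eps ^+ 3 * (c ^+ 2 * rec_sum (2 * p - 1) (fun=> 1) n) + M / eps.
Proof.
move=> p01 eps0 M0 Meps b1 bS.
have hp : 0 <= p /\ 0 <= 1 - p by case/andP: p01 => ? ?; split; lra.
set a := 2 * p - 1 in bS *.
have a1 : `|a| <= 1 by rewrite ler_norml /a; case/andP: p01 => ? ?; apply/andP; split; lra.
elim: n c s s' => [|n IH] c s s' cM es s'0 s'E.
  rewrite /= !mulr0 !add0r.
  have s0 : 0 < s by exact: lt_le_trans es.
  have -> : s' = s.
    by apply/eqP; rewrite -(@eqrXn2 _ 2)// ?ltW// s'E /= mulr0 addr0.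
  have cle : `|c| <= M.
    rewrite -(ler_pXn2r (ltn0Sn 1)) ?nnegrE// real_normK ?num_real//.
    by apply: le_trans cM; rewrite ler_peMr ?sqr_ge0.
  have -> : p * Phi ((x0 - c * 1) / s) + (1 - p) * Phi ((x0 - c * -1) / s) - Phi (x0 / s)
    = p * (Phi ((x0 - c * 1) / s) - Phi (x0 / s)) +
      (1 - p) * (Phi ((x0 - c * -1) / s) - Phi (x0 / s)) by ring.
  have cs : `|c / s| <= M / eps.
    rewrite normrM normfV (gtr0_norm s0) ler_pM ?invr_ge0 ?(ltW s0)//.
    by rewrite lef_pV2 ?posrE.
  apply: (le_trans (ler_normD _ _)); rewrite !normrM.
  have hA : `|Phi ((x0 - c * 1) / s) - Phi (x0 / s)| <= M / eps.
    apply: (le_trans (Phi_lip _ _)); rewrite -mulrBl mulr1 addrAC subrr add0r.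
    by rewrite mulNr normrN.
  have hB : `|Phi ((x0 - c * -1) / s) - Phi (x0 / s)| <= M / eps.
    apply: (le_trans (Phi_lip _ _)); rewrite -mulrBl mulrN1 opprK addrAC subrr add0r.
    by [].
  case: hp => p0 q0; rewrite (ger0_norm p0) (ger0_norm q0).
  have := ler_wpM2l p0 hA; have := ler_wpM2l q0 hB; lra.
have s0 : 0 < s by exact: lt_le_trans es.
have b0 k : 0 < b k by exact: lt_le_trans (b1 k).
pose r := 1 + a / n.+1%:R.
pose c1 := c * r.
pose s1 := Num.sqrt (s ^+ 2 + c ^+ 2).
have s1E : s1 ^+ 2 = s ^+ 2 + c ^+ 2 by rewrite sqr_sqrtr// addr_ge0// sqr_ge0.
have s10 : 0 < s1 by rewrite sqrtr_gt0 ltr_wpDr ?sqr_ge0// exprn_gt0.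
have es1 : eps <= s1.
  apply: (le_trans es); rewrite -(ler_pXn2r (ltn0Sn 1)) ?nnegrE; [|exact: ltW..].
  by rewrite s1E lerDl sqr_ge0.
have cle : `|c| <= M.
  rewrite -(ler_pXn2r (ltn0Sn 1)) ?nnegrE// real_normK ?num_real//.
  by apply: le_trans cM; rewrite ler_peMr ?sqr_ge0.
have c1M : c1 ^+ 2 * b n <= M ^+ 2.
  apply: le_trans cM; rewrite /c1 exprMn -(mulrA (c ^+ 2)) ler_wpM2l ?sqr_ge0//.
  exact: bS.
have s'E1 : s' ^+ 2 = s1 ^+ 2 + c1 ^+ 2 * rec_sum a (fun=> 1) n.
  by rewrite s'E s1E /c1 /= -/r; ring.
have {IH}IH := IH c1 s1 s' c1M es1 s'0 s'E1.
have step : `|erw_mean p n.+1 (fun x => Phi ((x0 - c * x) / s)) -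
    erw_mean p n (fun x => Phi ((x0 - c1 * x) / s1))| <=
    2 * a ^+ 2 / eps ^+ 2 * (c ^+ 2 * mean_sqr_rate p n.+1) +
    78 * M / eps ^+ 3 * c ^+ 2.
  rewrite /= -/a -[X in _ - X]mul1r -mulNr -erw_meanZ -erw_meanD.
  have -> : 2 * a ^+ 2 / eps ^+ 2 * (c ^+ 2 * mean_sqr_rate p n.+1) +
      78 * M / eps ^+ 3 * c ^+ 2 =
      erw_mean p n (fun x => 2 * (c / eps) ^+ 2 * (a / n.+1%:R) ^+ 2 * x ^+ 2
        + 78 * M / eps ^+ 3 * c ^+ 2).
    rewrite erw_meanD erw_mean_cst erw_meanZ /mean_sqr_rate /=.
    by field; rewrite nat1r pnatr_eq0 gt_eqF.
  apply: erw_mean_norm_le => // x xn.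
  have h1 : `|a * (x / n.+1%:R)| <= 1.
    rewrite normrM -[leRHS]mulr1 ler_pM// normrM normfV (ger0_norm (ler0n _ n.+1)).
    by rewrite ler_pdivrMr ?mul1r.
  have := @heat_step R (x0 - c1 * x) c s s1 (a * (x / n.+1%:R)) s0 s10 s1E
    (le_trans cle (le_trans Meps es)) h1.
  rewrite /erw_op mulN1r.
  have -> : x0 - c1 * x - c * (1 - a * (x / n.+1%:R)) = x0 - c * (x + 1).
    by rewrite /c1 /r; ring.
  have -> : x0 - c1 * x - c * (-1 - a * (x / n.+1%:R)) = x0 - c * (x - 1).
    by rewrite /c1 /r; ring.
  move=> h; apply: (le_trans h).
  have cs : `|c / s| <= `|c / eps|.
    rewrite !normrM !normfV (gtr0_norm s0) (gtr0_norm eps0) ler_wpM2l//.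
    by rewrite lef_pV2 ?posrE.
  have cs2 : (c / s) ^+ 2 <= (c / eps) ^+ 2.
    by rewrite -(real_normK (num_real (c / s))) -(real_normK (num_real (c / eps)))
      lerXn2r ?nnegrE.
  apply: lerD.
    have -> : (a * (x / n.+1%:R)) ^+ 2 = (a / n.+1%:R) ^+ 2 * x ^+ 2 by ring.
    rewrite -[leRHS](mulrA (2 * (c / eps) ^+ 2)) ler_wpM2r//.
      by apply: mulr_ge0; exact: sqr_ge0.
    by rewrite ler_wpM2l.
  have -> : 78 * M / eps ^+ 3 * c ^+ 2 = 78 * ((c / eps) ^+ 2 * (M / eps)).
    by field; rewrite gt_eqF.
  rewrite ler_wpM2l// exprSr ler_pM//.
    by rewrite real_normK ?num_real.
  apply: (le_trans cs); rewrite normrM normfV (gtr0_norm eps0) ler_wpM2r//.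
  by rewrite invr_ge0 ltW.
rewrite -(subrKA (erw_mean p n (fun x => Phi ((x0 - c1 * x) / s1)))).
apply: (le_trans (ler_normD _ _)); apply: (le_trans (lerD step IH)).
rewrite [X in _ <= X](_ : _ = (2 * a ^+ 2 / eps ^+ 2 *
      (c ^+ 2 * mean_sqr_rate p n.+1) + 78 * M / eps ^+ 3 * c ^+ 2) +
  (2 * a ^+ 2 / eps ^+ 2 * (c1 ^+ 2 * rec_sum a (mean_sqr_rate p) n) +
    78 * M / eps ^+ 3 * (c1 ^+ 2 * rec_sum a (fun=> 1) n) + M / eps)) //.
by rewrite /c1 /= -/r; ring.
Qed.

End erw_mean.

(** * Central limit theorem for the chain *)

Section erw_clt.
Context {R : realType}.

Lemma mean_sqr_rate_cvg (p : R) : 0 <= p <= 3 / 4 ->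
  mean_sqr_rate p n @[n --> \oo] --> (0 : R).
Proof. by move=> p34; rewrite -cvg_shiftS; exact: erw_mean_sqr_small. Qed.

(** The variance accumulated by the heat flow converges and the errors vanish.
    The factor [theta] lets the normalisation depend on more than [k n]. *)
Lemma erw_clt (p : R) w lambda b (k : nat -> nat) (theta : nat -> R) (th eps x0 : R) :
  0 < p -> p <= 3 / 4 -> scaling (2 * p - 1) w lambda b ->
  k n @[n --> \oo] --> \oo -> theta n @[n --> \oo] --> th -> 0 < eps ->
  erw_mean p (k n) (fun x => Phi ((x0 - theta n / Num.sqrt (w (k n)) * x) / eps))
    @[n --> \oo] --> Phi (x0 / Num.sqrt (eps ^+ 2 + th ^+ 2 / lambda)).
Proof.
move=> p0 p34 S koo thcvg eps0; have [l0 wl b1 bS w0 bw] := S.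
have p34' : 0 <= p <= 3 / 4 by rewrite p34 ltW.
have p01 : 0 <= p <= 1 by apply/andP; split; lra.
set a := 2 * p - 1 in S wl bS.
pose u n := theta n ^+ 2 * (rec_sum a (fun=> 1) (k n) / w (k n)).
pose v n := theta n ^+ 2 * (rec_sum a (mean_sqr_rate p) (k n) / w (k n)).
pose M n := Num.sqrt (theta n ^+ 2 * (b (k n) / w (k n))).
pose s' n := Num.sqrt (eps ^+ 2 + u n).
have th2 : theta n ^+ 2 @[n --> \oo] --> th ^+ 2 by exact: cvgM.
have sub (f : nat -> R) (l : R) : f j @[j --> \oo] --> l -> f (k n) @[n --> \oo] --> l.
  by move=> h; apply: (@cvg_comp _ _ _ k f _ \oo).
have w0' : \forall n \near \oo, 0 < w (k n) by exact: (koo _ w0).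
have ucvg : u n @[n --> \oo] --> th ^+ 2 / lambda.
  by apply: cvgM => //; exact: (sub _ _ (rec_sum1_cvg S)).
have vcvg : v n @[n --> \oo] --> (0 : R).
  rewrite -(mulr0 (th ^+ 2)); apply: cvgM => //.
  exact: (sub _ _ (rec_sum_small S (mean_sqr_rate_cvg p34'))).
have Mcvg : M n @[n --> \oo] --> (0 : R).
  have h0 : theta n ^+ 2 * (b (k n) / w (k n)) @[n --> \oo] --> (0 : R).
    by rewrite -[X in _ --> X](mulr0 (th ^+ 2)); apply: cvgM => //; exact: (sub _ _ bw).
  by have := cvg_seq_continuous h0 (@sqrt_continuous R _); rewrite sqrtr0.
have Bcvg : Phi (x0 / s' n) @[n --> \oo] --> Phi (x0 / Num.sqrt (eps ^+ 2 + th ^+ 2 / lambda)).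
  have h1 : eps ^+ 2 + u n @[n --> \oo] --> eps ^+ 2 + th ^+ 2 / lambda.
    by apply: cvgD => //; exact: cvg_cst.
  have h2 := cvg_seq_continuous h1 (@sqrt_continuous R _).
  have h3 : Num.sqrt (eps ^+ 2 + th ^+ 2 / lambda) != 0.
    by rewrite gt_eqF// sqrtr_gt0 ltr_wpDr ?exprn_gt0// divr_ge0 ?sqr_ge0// ltW.
  have h4 : x0 / s' n @[n --> \oo] --> x0 / Num.sqrt (eps ^+ 2 + th ^+ 2 / lambda).
    by apply: cvgM (cvg_cst _) (cvgV h3 h2).
  exact: (cvg_seq_continuous h4 (@continuous_Phi _ _)).
pose A n := erw_mean p (k n)
  (fun x => Phi ((x0 - theta n / Num.sqrt (w (k n)) * x) / eps)).
have ABcvg : A n - Phi (x0 / s' n) @[n --> \oo] --> (0 : R).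
  apply/norm_cvg0P.
  apply: (@squeeze_cvgr _ _ _ _ (fun=> 0) (fun n => 2 * a ^+ 2 / eps ^+ 2 * v n +
    78 * M n / eps ^+ 3 * u n + M n / eps)); last 2 first.
  - exact: cvg_cst.
  - rewrite -[X in _ --> X](_ : 2 * a ^+ 2 / eps ^+ 2 * 0 +
      78 * 0 / eps ^+ 3 * (th ^+ 2 / lambda) + 0 / eps = 0); last by rewrite !(mul0r, mulr0, addr0).
    have h1 : 78 * M n / eps ^+ 3 @[n --> \oo] --> 78 * 0 / eps ^+ 3.
      exact: (cvgM (cvgM (cvg_cst _) Mcvg) (cvg_cst _)).
    exact: (cvgD (cvgD (cvgM (cvg_cst _) vcvg) (cvgM h1 ucvg)) (cvgM Mcvg (cvg_cst _))).
  near=> n; rewrite normr_ge0/=.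
  have wn : 0 < w (k n) by near: n.
  have sE : (theta n / Num.sqrt (w (k n))) ^+ 2 = theta n ^+ 2 / w (k n).
    by rewrite exprMn exprVn sqr_sqrtr// ltW.
  have bk0 : 0 <= theta n ^+ 2 * (b (k n) / w (k n)).
    by rewrite mulr_ge0 ?sqr_ge0// divr_ge0 ?ltW// (lt_le_trans ltr01).
  have u0 : 0 <= u n.
    by rewrite mulr_ge0 ?sqr_ge0// divr_ge0 ?(ltW wn)// rec_sum_ge0.
  have := @erw_heat_bound R p b (M n) eps x0 (k n)
    (theta n / Num.sqrt (w (k n))) eps (s' n) p01 eps0.
  rewrite sE -/a.
  have -> : theta n ^+ 2 / w (k n) * rec_sum a (mean_sqr_rate p) (k n) = v n.
    by rewrite /v; ring.
  have -> : theta n ^+ 2 / w (k n) * rec_sum a (fun=> 1) (k n) = u n.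
    by rewrite /u; ring.
  apply => //.
  - exact: sqrtr_ge0.
  - near: n; move/cvgr_le : Mcvg; exact.
  - by rewrite /M sqr_sqrtr//; rewrite le_eqVlt; apply/orP; left; apply/eqP; ring.
  - by rewrite sqrtr_gt0 ltr_wpDr ?exprn_gt0.
  - by rewrite sqr_sqrtr// addr_ge0// sqr_ge0.
have -> : (fun n => erw_mean p (k n)
    (fun x => Phi ((x0 - theta n / Num.sqrt (w (k n)) * x) / eps))) =
    (fun n => (A n - Phi (x0 / s' n)) + Phi (x0 / s' n)).
  by apply/funext => n; rewrite subrK.
by rewrite -[X in _ --> X]add0r; apply: cvgD.
Unshelve. all: by end_near. Qed.

End erw_clt.

(** * Random variables with finitely many values *)

Section finite_range.
Context {d : measure_display} {T : measurableType d} {R : realType}.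
Variable P : probability T R.
Implicit Types (G : set (set T)) (Y Z : T -> R) (A B : set T).

Local Notation E f := (Rintegral P setT f).

(** Up to null sets, every variable built from the steps has finitely many
    values.  Measurability can then be checked on level sets, arbitrary
    functions may be applied, and expectations are finite sums. *)
Definition fin_rv G Y : Prop :=
  (exists s : seq R, forall w, Y w \in s) /\ forall y, <<s G >> (Y @^-1` [set y]).

(** Each level set is a finite union of intersections of level sets. *)
Lemma fin_rv2 G (f : R -> R -> R) Y Z :
  fin_rv G Y -> fin_rv G Z -> fin_rv G (fun w => f (Y w) (Z w)).
Proof.
move=> [[s sY] mY] [[t tZ] mZ]; split.
  exists [seq f x y | x <- s, y <- t] => w.
  by apply/allpairsP; exists (Y w, Z w); split => /=.
move=> y.
have -> : (fun w => f (Y w) (Z w)) @^-1` [set y] =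
    \bigcup_(q in [set` [seq (u, v) | u <- s, v <- t]] `&` [set q | f q.1 q.2 = y])
      (Y @^-1` [set q.1] `&` Z @^-1` [set q.2]).
  apply/seteqP; split => [w /= fw|w [[u v] [_ /=] <- [-> ->]]//].
  exists (Y w, Z w) => //=; split => //=.
  by apply/allpairsP; exists (Y w, Z w); split => /=.
apply: (@fin_bigcup_measurable _ (g_sigma_algebraType G)).
  exact: finite_setIl.
by move=> q _; apply: (@measurableI _ (g_sigma_algebraType G)); [exact: mY|exact: mZ].
Qed.

Lemma fin_rv1 G (f : R -> R) Y : fin_rv G Y -> fin_rv G (fun w => f (Y w)).
Proof. by move=> h; apply: (fin_rv2 (fun x _ => f x) h h). Qed.

Lemma fin_rv_cst G c : fin_rv G (fun=> c).
Proof.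
split; first by exists [:: c] => w; rewrite inE.
move=> y; have [<-|cy] := eqVneq c y.
  by rewrite (_ : _ @^-1` _ = setT); [exact: (@measurableT _ (g_sigma_algebraType G))|apply/seteqP; split].
rewrite (_ : _ @^-1` _ = set0); first exact: (@measurable0 _ (g_sigma_algebraType G)).
by apply/seteqP; split => // w /= /eqP; rewrite (negbTE cy).
Qed.

Lemma fin_rv_sum G (I : Type) (r : seq I) (F : I -> T -> R) (Q : pred I) :
  (forall i, Q i -> fin_rv G (F i)) -> fin_rv G (fun w => \sum_(i <- r | Q i) F i w).
Proof.
move=> h; elim: r => [|i r IH].
  by under [X in fin_rv G X]eq_fun do rewrite big_nil; exact: fin_rv_cst.
under [X in fin_rv G X]eq_fun do rewrite big_cons.
case Qi : (Q i) => //; apply: (fin_rv2 (fun x y => x + y)) => //; exact: h.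
Qed.

Lemma fin_rv_sub G G' Y : <<s G >> `<=` <<s G' >> -> fin_rv G Y -> fin_rv G' Y.
Proof. by move=> GG' [sY mY]; split => // y; exact: GG'. Qed.

Lemma fin_rv_measurable Y : fin_rv measurable Y -> measurable_fun setT Y.
Proof.
move=> [[s sY] mY] _ B mB; rewrite setTI.
have -> : Y @^-1` B = \bigcup_(y in [set` s] `&` B) Y @^-1` [set y].
  apply/seteqP; split => [w Bw|w [y [_ By] /= ->]//].
  by exists (Y w) => //; split => //=; exact: sY.
apply: fin_bigcup_measurable; first exact: finite_setIl.
by move=> y _; have := mY y; rewrite sigma_algebra_id//; exact: sigma_algebra_measurable.
Qed.

Lemma fin_rv_integrable Y : fin_rv measurable Y -> P.-integrable setT (EFin \o Y).
Proof.
move=> fY; apply: measurable_bounded_integrable => //.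
- by apply: (@le_lt_trans _ _ 1%E); [exact: probability_le1|exact: ltry].
- exact: fin_rv_measurable.
- have [[s sY] _] := fY.
  exists (\sum_(y <- s) `|y|); split; first exact: num_real.
  move=> M sM w _ /=; apply: (le_trans _ (ltW sM)).
  by rewrite (big_rem _ (sY w))/= lerDl sumr_ge0.
Qed.

Lemma Rintegral_ae_eq Y Z : measurable_fun setT Y ->
  measurable_fun setT Z -> {ae P, forall w, Y w = Z w} ->
  Rintegral P setT Y = Rintegral P setT Z.
Proof.
move=> mY mZ YZ; congr fine; apply: ae_eq_integral => //.
- exact/measurable_EFinP.
- exact/measurable_EFinP.
- by apply: filterS YZ => w /= ->.
Qed.

Lemma mean_ae_eq Y Z : fin_rv measurable Y -> fin_rv measurable Z ->
  {ae P, forall w, Y w = Z w} -> E Y = E Z.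
Proof. by move=> fY fZ; apply: Rintegral_ae_eq; exact: fin_rv_measurable. Qed.

Lemma meanD Y Z : fin_rv measurable Y -> fin_rv measurable Z ->
  E (fun w => Y w + Z w) = E Y + E Z.
Proof. by move=> fY fZ; rewrite RintegralD//; exact: fin_rv_integrable. Qed.

Lemma meanZ c Y : fin_rv measurable Y -> E (fun w => c * Y w) = c * E Y.
Proof. by move=> fY; rewrite RintegralZl//; exact: fin_rv_integrable. Qed.

Lemma mean_cst c : E (fun=> c) = c.
Proof.
rewrite Rintegral_cst//; have PT : (P : set T -> \bar R) setT = 1%E by exact: probability_setT.
by move: PT => /= ->; rewrite mulr1.
Qed.

Lemma mean_le Y Z : fin_rv measurable Y -> fin_rv measurable Z ->
  (forall w, Y w <= Z w) -> E Y <= E Z.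
Proof. by move=> fY fZ YZ; apply: le_Rintegral => //; exact: fin_rv_integrable. Qed.

Lemma mean_norm Y : fin_rv measurable Y -> `|E Y| <= E (fun w => `|Y w|).
Proof. by move=> fY; apply: le_normr_Rintegral => //; exact: fin_rv_integrable. Qed.

Lemma mean_sum (I : Type) (r : seq I) (F : I -> T -> R) (Q : pred I) :
  (forall i, Q i -> fin_rv measurable (F i)) ->
  E (fun w => \sum_(i <- r | Q i) F i w) = \sum_(i <- r | Q i) E (F i).
Proof.
move=> h; elim: r => [|i r IH].
  by rewrite big_nil; under eq_Rintegral do rewrite big_nil; rewrite mean_cst.
rewrite big_cons; under eq_Rintegral do rewrite big_cons.
case: ifPn => // Qi; rewrite meanD ?IH//; first exact: h.
exact: fin_rv_sum.
Qed.

Lemma fin_rv_indicG G A : <<s G >> A -> fin_rv G (\1_A : T -> R).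
Proof.
move=> mA; split.
  by exists [:: 0; 1] => w; rewrite indicE !inE; case: (_ \in _); rewrite eqxx ?orbT.
move=> y.
have -> : (\1_A : T -> R) @^-1` [set y] =
    (if y == 1 then A else set0) `|` (if y == 0 then ~` A else set0).
  apply/seteqP; split => w /=; rewrite indicE.
    have [wA|wA] := boolP (w \in A) => <-.
      by left; rewrite eqxx; exact: set_mem.
    by right; rewrite eqxx => wA'; move: wA; rewrite mem_set.
  case=> [|]; case: eqP => // -> wA; first by rewrite mem_set.
  by rewrite memNset.
have m0 := @measurable0 _ (g_sigma_algebraType G).
apply: (@measurableU _ (g_sigma_algebraType G)); case: ifP => // _.
exact: (@measurableC _ (g_sigma_algebraType G)).
Qed.

Lemma fin_rv_indic A : measurable A -> fin_rv measurable (\1_A : T -> R).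
Proof. by move=> mA; apply: fin_rv_indicG; exact: sub_sigma_algebra. Qed.

Lemma mean_indic A : measurable A -> E (\1_A : T -> R) = fine (P A).
Proof. by move=> mA; rewrite /Rintegral integral_indic// setIT. Qed.

(** The product rule for events extends to [Y] by writing [Y] as the sum of its
    values times the indicator functions of its level sets. *)
Lemma mean_indep G Y B : G `<=` measurable -> fin_rv G Y -> measurable B ->
  (forall A, <<s G >> A -> P (A `&` B) = (P A * P B)%E) ->
  E (fun w => Y w * \1_B w) = E Y * fine (P B).
Proof.
move=> Gm fY mB ind.
have sGm : <<s G >> `<=` measurable.
  by apply: smallest_sub => //; exact: sigma_algebra_measurable.
have [[s sY] mY] := fY.
have YE w : Y w = \sum_(y <- undup s) y * \1_(Y @^-1` [set y]) w.
  rewrite (bigD1_seq (Y w)) ?undup_uniq ?mem_undup//= indicE mem_set// mulr1.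
  rewrite big1 ?addr0// => y yY; rewrite indicE memNset ?mulr0//=.
  by move=> /esym/eqP; rewrite (negbTE yY).
have fI (A : set T) c : measurable A -> fin_rv measurable (fun w => c * \1_A w).
  by move=> mA; apply: (fin_rv1 (fun x => c * x)); exact: fin_rv_indic.
have -> : E Y = \sum_(y <- undup s) y * fine (P (Y @^-1` [set y])).
  under eq_Rintegral do rewrite YE.
  rewrite mean_sum; last by move=> y _; apply: fI; exact: sGm.
  apply: eq_bigr => y _; rewrite meanZ; last by apply: fin_rv_indic; exact: sGm.
  by rewrite mean_indic//; exact: sGm.
rewrite big_distrl /=.
transitivity (E (fun w => \sum_(y <- undup s) y * \1_(Y @^-1` [set y] `&` B) w)).
  apply: eq_Rintegral => w _; rewrite [in LHS]YE big_distrl /=.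
  by apply: eq_bigr => y _; rewrite -mulrA indicI.
rewrite mean_sum; last by move=> y _; apply: fI; apply: measurableI => //; exact: sGm.
apply: eq_bigr => y _; rewrite meanZ; last first.
  by apply: fin_rv_indic; apply: measurableI => //; exact: sGm.
rewrite mean_indic; last by apply: measurableI => //; exact: sGm.
by rewrite ind// fineM ?mulrA// fin_num_measure//; exact: sGm.
Qed.

End finite_range.

(** * One step of an elephant random walk *)

Section steps.
Context {d : measure_display} {T : measurableType d} {R : realType}.
Variable P : probability T R.
Implicit Types (X : nat -> {RV P >-> R}) (Z : T -> R).

Local Notation E f := (Rintegral P setT f).

(** The generators of the sigma-algebra [past X k]. *)
Definition past_gen X k : set (set T) :=
  \bigcup_(i in [set i : nat | (1 <= i <= k)%N]) sigma_rv (X i).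

(** A step is 1 or -1 only almost surely.  This version is so everywhere and is
    measurable with respect to the step. *)
Definition sg X i (w : T) : R := 2 * \1_(X i @^-1` [set 1]) w - 1.

Definition sgwalk X n (w : T) : R := \sum_(1 <= i < n.+1) sg X i w.

Lemma one_neqN1 : (1 : R) <> -1.
Proof. by apply/eqP; rewrite gt_eqF//; lra. Qed.

Lemma sgE X i w : X i w = 1 \/ X i w = -1 -> sg X i w = X i w.
Proof.
rewrite /sg indicE; case=> Xw.
  by rewrite mem_set//= Xw; ring.
rewrite memNset/= Xw; first by ring.
by move/esym/one_neqN1.
Qed.

Lemma sg_pm1 X i w : sg X i w = 1 \/ sg X i w = -1.
Proof.
by rewrite /sg indicE; case: (_ \in _); [left|right]; rewrite /=; ring.
Qed.

Lemma preimage_meas (d' : measure_display) (T' : measurableType d')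
  (Y : {RV P >-> T'}) B : measurable B -> measurable (Y @^-1` B).
Proof. by move=> mB; rewrite -[X in measurable X]setTI; exact: measurable_funP. Qed.

Lemma past_gen_measurable X k : past_gen X k `<=` measurable.
Proof. by move=> A [i _ [B mB <-]]; exact: measurable_funP. Qed.

Lemma past_measurable X k : <<s past_gen X k >> `<=` measurable.
Proof.
apply: smallest_sub; [exact: sigma_algebra_measurable|exact: past_gen_measurable].
Qed.

Lemma fin_rv_sg X k i : (1 <= i <= k)%N -> fin_rv (past_gen X k) (sg X i).
Proof.
move=> ik; apply: (fin_rv1 (fun x => 2 * x - 1)); apply: fin_rv_indicG.
by apply: sub_sigma_algebra; exists i => //; exists [set 1] => //; rewrite setTI.
Qed.

Lemma fin_rv_sgwalk X k n : (n <= k)%N -> fin_rv (past_gen X k) (sgwalk X n).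
Proof.
move=> nk; rewrite /sgwalk; under [X in fin_rv _ X]eq_fun do rewrite big_nat.
apply: fin_rv_sum => i /andP[i1 i2]; apply: fin_rv_sg.
by rewrite i1 (leq_trans _ nk).
Qed.

Lemma fin_rv_past X k Z : fin_rv (past_gen X k) Z -> fin_rv measurable Z.
Proof.
apply: fin_rv_sub; apply: subset_trans; first exact: past_measurable.
exact: sub_sigma_algebra.
Qed.

Lemma ae_prob1 A : measurable A -> P A = 1%E -> {ae P, forall w, A w}.
Proof.
move=> mA PA; exists (~` A); split => //; first exact: measurableC.
by have := probability_setC P mA; rewrite PA subee.
Qed.

Lemma ae_pm1 (Y : {RV P >-> R}) q : P (Y @^-1` [set 1]) = q%:E ->
  P (Y @^-1` [set -1]) = (1 - q)%:E -> {ae P, forall w, Y w = 1 \/ Y w = -1}.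
Proof.
move=> h1 h2; have : {ae P, forall w, (Y @^-1` [set 1] `|` Y @^-1` [set -1]) w}.
  apply: ae_prob1; first by apply: measurableU; exact: preimage_meas.
  rewrite measureU; [|exact: preimage_meas..|].
    by rewrite [X in (X + _)%E](h1) [X in (_ + X)%E](h2) -EFinD addrC subrK.
  by apply/seteqP; split => // w [/= -> /one_neqN1].
by apply: filterS => w /= .
Qed.

(** The probabilities of the [r] prescribed values add up to 1. *)
Lemma ae_uniform (K : {RV P >-> nat}) r : (0 < r)%N ->
  (forall i : nat, (1 <= i <= r)%N -> P (K @^-1` [set i]) = (r%:R^-1)%:E) ->
  {ae P, forall w, (1 <= K w <= r)%N}.
Proof.
move=> r0 Kr.
have mK i : measurable (K @^-1` [set i]) by exact: preimage_meas.
have mA : measurable (K @^-1` [set i | (1 <= i <= r)%N]) by exact: preimage_meas.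
apply: (ae_prob1 mA).
have : E (\1_(K @^-1` [set i | (1 <= i <= r)%N]) : T -> R) = 1.
  transitivity (E (fun w => \sum_(1 <= i < r.+1) \1_(K @^-1` [set i]) w)).
    apply: eq_Rintegral => w _ /=.
    have [/set_mem /= Kw|Kw] := boolP (w \in _).
      rewrite (bigD1_seq (K w)) ?iota_uniq ?mem_index_iota//=.
      rewrite indicE mem_set// big1 ?addr0// => i iK.
      by rewrite indicE memNset//= => /esym/eqP; rewrite (negbTE iK).
    rewrite big_nat big1// => i i1; rewrite indicE memNset//= => Ki.
    by move/negP: Kw; apply; rewrite inE/= Ki.
  rewrite mean_sum; last by move=> i _; exact: fin_rv_indic.
  rewrite big_nat; under eq_bigr => i i1.
    rewrite mean_indic//.
    rewrite [P _](Kr i i1) /=. over.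
  rewrite -big_nat /= sumr_const_nat subn1 /= -[LHS]mulr_natr mulVf// pnatr_eq0.
  by rewrite -lt0n.
rewrite mean_indic// => h; rewrite -(@fineK _ (P _)) ?fin_num_measure//.
by rewrite [fine _]h.
Qed.

Definition pm1_upto X k : Prop :=
  {ae P, forall w, forall i, (1 <= i <= k)%N -> X i w = 1 \/ X i w = -1}.

Lemma erw_step_pm1 p X k r : (0 < r <= k)%N -> pm1_upto X k ->
  erw_step p X k r -> pm1_upto X k.+1.
Proof.
move=> /andP[r0 rk] Xk [K [e [Kr e1 e2 ind Xe]]].
have he := ae_pm1 e1 e2; have hK := ae_uniform r0 Kr.
near=> w => i /andP[i1]; rewrite leq_eqVlt => /predU1P[->|].
  have -> : X k.+1 w = e w * X (K w) w by near: w.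
  have Kw : (1 <= K w <= r)%N by near: w.
  have XK : X (K w) w = 1 \/ X (K w) w = -1.
    have : (1 <= K w <= k)%N by case/andP: Kw => -> /leq_trans; exact.
    by move: {Kw} (K w); near: w.
  have ew : e w = 1 \/ e w = -1 by near: w.
  by case: ew => ->; case: XK => ->; rewrite ?mulrNN ?mulN1r ?mul1r; [left|right|right|left].
rewrite ltnS => ik; have : (1 <= i <= k)%N by rewrite i1.
by move: i {i1 ik}; near: w.
Unshelve. all: by end_near. Qed.

(** Given the past, the next step has mean [(2 * p - 1) * S_r / r].  The values
    of the pair [(K, e)] split the expectation into [2 * r] pieces, and the
    independence of [K], [e] and the past factors each of them. *)
Lemma erw_step_mean p X k r Z : (0 < r <= k)%N -> pm1_upto X k ->
  erw_step p X k r -> fin_rv (past_gen X k) Z ->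
  E (fun w => Z w * sg X k.+1 w) =
  (2 * p - 1) / r%:R * E (fun w => Z w * sgwalk X r w).
Proof.
move=> /[dup] rk0 /andP[r0 rk] Xk /[dup] st [K [e [Kr e1 e2 ind Xe]]] fZ.
have he := ae_pm1 e1 e2; have hK := ae_uniform r0 Kr.
have Xk1 := erw_step_pm1 rk0 Xk st.
pose A i := K @^-1` [set i] `&` e @^-1` [set 1].
pose B i := K @^-1` [set i] `&` e @^-1` [set -1].
have mA i : measurable (A i) by apply: measurableI; exact: preimage_meas.
have mB i : measurable (B i) by apply: measurableI; exact: preimage_meas.
pose Y i w := Z w * sg X i w.
have fY i : (1 <= i <= k)%N -> fin_rv (past_gen X k) (Y i).
  by move=> ik; apply: (fin_rv2 (fun x y => x * y)) => //; exact: fin_rv_sg.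
have fsg i : (1 <= i <= k.+1)%N -> fin_rv measurable (sg X i).
  by move=> ik; apply: (@fin_rv_past X k.+1); exact: fin_rv_sg.
have fZ' := fin_rv_past fZ.
have fYI i (C : set T) : (1 <= i <= k)%N -> measurable C ->
    fin_rv measurable (fun w => Y i w * \1_C w).
  move=> ik mC; apply: (fin_rv2 (fun x y => x * y)); last exact: fin_rv_indic.
  exact: (fin_rv_past (fY _ ik)).
have PAB i (q : R) (x : R) : (1 <= i <= r)%N -> P (e @^-1` [set x]) = q%:E ->
    E (fun w => Y i w * \1_(K @^-1` [set i] `&` e @^-1` [set x]) w) =
    E (Y i) * (r%:R^-1 * q).
  move=> ir eq.
  have sK : sigma_rv K (K @^-1` [set i]) by exists [set i] => //; rewrite setTI.
  have se : sigma_rv e (e @^-1` [set x]) by exists [set x] => //; rewrite setTI.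
  have PC : P (K @^-1` [set i] `&` e @^-1` [set x]) = (r%:R^-1 * q)%:E.
    have := ind setT _ _ (@measurableT _ (g_sigma_algebraType (past_gen X k))) sK se.
    rewrite setTI => ->; rewrite probability_setT mul1e.
    by rewrite [X in (X * _)%E](Kr i ir) [X in (_ * X)%E](eq).
  rewrite (@mean_indep _ _ _ P (past_gen X k)).
  - by rewrite [X in fine X]PC.
  - exact: past_gen_measurable.
  - by apply: fY; case/andP: ir => -> /leq_trans; exact.
  - by apply: measurableI; exact: preimage_meas.
  - move=> C mC; have := ind C _ _ mC sK se; rewrite setIA => ->.
    rewrite -muleA; congr (_ * _)%E.
    by rewrite [RHS]PC [X in (X * _)%E](Kr i ir) [X in (_ * X)%E](eq) -EFinM.
transitivity (E (fun w : T => \sum_(1 <= i < r.+1) (Y i w * \1_(A i) w + -1 * (Y i w * \1_(B i) w)))).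
  apply: mean_ae_eq.
  - by apply: (fin_rv2 (fun x y => x * y)) => //; apply: fsg; rewrite leqnn.
  - under [X in fin_rv _ X]eq_fun do rewrite big_nat.
    apply: fin_rv_sum => i /andP[i1 i2].
    have ik : (1 <= i <= k)%N by rewrite i1 (leq_trans _ rk).
    apply: (fin_rv2 (fun x y => x + y)); first exact: fYI.
    by apply: (fin_rv1 (fun x => -1 * x)); exact: fYI.
  near=> w.
  have XE : X k.+1 w = e w * X (K w) w by near: w.
  have Kw : (1 <= K w <= r)%N by near: w.
  have Xpm : forall i, (1 <= i <= k.+1)%N -> X i w = 1 \/ X i w = -1 by near: w.
  have ew : e w = 1 \/ e w = -1 by near: w.
  have Kk : (1 <= K w <= k.+1)%N.
    by case/andP: Kw => -> /leq_trans; apply; rewrite ltnW.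
  rewrite (bigD1_seq (K w)) ?iota_uniq ?mem_index_iota//=.
  rewrite big1 ?addr0; last first.
    move=> i iK; rewrite !indicE !memNset ?mulr0 ?addr0//=.
      by case=> /esym/eqP; rewrite (negbTE iK).
    by case=> /esym/eqP; rewrite (negbTE iK).
  rewrite (sgE (Xpm k.+1 _)) ?leqnn// XE -(sgE (Xpm _ Kk)) /Y !indicE.
  have n1 := one_neqN1.
  case: ew => ew.
    have wA : A (K w) w by split.
    have wB : ~ B (K w) w by move=> [_ /=]; rewrite ew => /n1.
    by rewrite (mem_set wA) (memNset wB) ew /=; ring.
  have wA : ~ A (K w) w by move=> [_ /=]; rewrite ew => /esym/n1.
  have wB : B (K w) w by split.
  by rewrite (memNset wA) (mem_set wB) ew /=; ring.
have ik i : (1 <= i < r.+1)%N -> (1 <= i <= k)%N.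
  by move=> /andP[-> i2]; rewrite (leq_trans _ rk).
under eq_Rintegral do rewrite big_nat.
rewrite mean_sum; last first.
  move=> i /ik ir; apply: (fin_rv2 (fun x y => x + y)); first exact: fYI.
  by apply: (fin_rv1 (fun x => -1 * x)); exact: fYI.
rewrite /sgwalk.
under [in RHS]eq_Rintegral do rewrite big_nat mulr_sumr.
rewrite mean_sum; last by move=> i /ik ir; exact: (fin_rv_past (fY _ ir)).
rewrite mulr_sumr; apply: eq_bigr => i ir.
rewrite meanD; [|exact: fYI (ik _ ir) _|].
  rewrite meanZ; last exact: fYI (ik _ ir) _.
  by rewrite (PAB _ p)// (PAB _ (1 - p))// /Y; ring.
by apply: (fin_rv1 (fun x => -1 * x)); exact: fYI (ik _ ir) _.
Unshelve. all: by end_near. Qed.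

End steps.

(** * Full and restricted memory *)

Section laws.
Context {d : measure_display} {T : measurableType d} {R : realType}.
Variable P : probability T R.
Implicit Types (X : nat -> {RV P >-> R}).

Local Notation E f := (Rintegral P setT f).

Lemma walkE X n w : walk X n w = \sum_(1 <= k < n.+1) X k w.
Proof. exact: mfun_sum. Qed.

Lemma sgwalkS X n w : sgwalk X n.+1 w = sgwalk X n w + sg X n.+1 w.
Proof. by rewrite /sgwalk (big_nat_recr n.+1). Qed.

Lemma sgwalk1 X w : sgwalk X 1 w = sg X 1 w.
Proof. by rewrite /sgwalk big_nat1. Qed.

Lemma walk_sgwalk X n : pm1_upto X n ->
  {ae P, forall w, walk X n w = sgwalk X n w}.
Proof.
apply: filterS => w Xw; rewrite walkE; apply: eq_big_nat => i ik.
by rewrite sgE//; apply: Xw.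
Qed.

(** A function of a sign is affine, so that its conditional expectation only
    involves the conditional mean of the sign. *)
Lemma fun_sg X (g : R -> R) i w (x : R) :
  g (x + sg X i w) = (g (x + 1) + g (x - 1)) / 2 +
    (g (x + 1) - g (x - 1)) / 2 * sg X i w.
Proof. by case: (sg_pm1 X i w) => ->; field. Qed.

Lemma pm1_upto1 p X : erw_init p X -> pm1_upto X 1.
Proof.
move=> [X1 X2]; have := ae_pm1 X1 X2; apply: filterS => w Xw i.
by rewrite -eqn_leq => /eqP <-.
Qed.

Lemma full_pm1 p X m : (0 < m)%N -> erw_init p X ->
  (forall k, (1 <= k < m)%N -> erw_step p X k k) -> pm1_upto X m.
Proof.
case: m => // m _ X1; elim: m => [|m IH] Xs; first exact: pm1_upto1 X1.
apply: (@erw_step_pm1 _ _ _ P p X m.+1 m.+1).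
- by rewrite leqnn.
- apply: IH => k /andP[k1 k2]; apply: Xs; rewrite k1.
  exact: ltnW.
- by apply: Xs; rewrite leqnn.
Qed.

Lemma restricted_pm1 p m n X : (0 < m <= n)%N -> restricted_erw p m n X ->
  forall k, (m <= k <= n)%N -> pm1_upto X k.
Proof.
move=> /andP[m0 mn] [X1 Xs1 Xs2]; elim=> [|k IH] /andP[mk kn].
  by move: mk m0; rewrite leqn0 => /eqP ->.
move: mk; rewrite leq_eqVlt => /predU1P[<-|]; first exact: full_pm1 X1 Xs1.
rewrite ltnS => mk.
apply: (@erw_step_pm1 _ _ _ P p X k m).
- by rewrite m0.
- by apply: IH; rewrite mk (ltnW kn).
- by apply: Xs2; rewrite mk.
Qed.

Lemma fin_rv_past_fun X k n (g : R -> R) : (n <= k)%N ->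
  fin_rv (past_gen X k) (fun w => g (sgwalk X n w)).
Proof. by move=> nk; apply: fin_rv1; exact: fin_rv_sgwalk. Qed.

Lemma fin_rv_fun X n (g : R -> R) : fin_rv measurable (fun w => g (sgwalk X n w)).
Proof. exact: (fin_rv_past (fin_rv_past_fun X g (leqnn n))). Qed.

Lemma fin_rv_sgT X i : (0 < i)%N -> fin_rv measurable (sg X i).
Proof. by move=> i0; apply: (@fin_rv_past _ _ _ P X i); apply: fin_rv_sg; rewrite i0 leqnn. Qed.

Lemma mean_sg1 p X : erw_init p X -> E (sg X 1) = 2 * p - 1.
Proof.
move=> [X1 _]; rewrite /sg.
have mA : measurable (X 1%N @^-1` [set 1]) by exact: preimage_meas.
have fA := @fin_rv_indic _ _ R _ mA.
rewrite (@meanD _ _ _ P (fun w => 2 * \1_(X 1%N @^-1` [set 1]) w) (fun=> -1)).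
- by rewrite meanZ// mean_indic// mean_cst [X in fine X]X1.
- exact: (fin_rv1 (fun x => 2 * x)).
- exact: fin_rv_cst.
Qed.

(** The law of the walk is determined by [p] alone, whatever the probability
    space. *)
Lemma full_erw_law p X m : erw_init p X ->
  (forall k, (1 <= k < m)%N -> erw_step p X k k) ->
  forall k, (k < m)%N -> forall g : R -> R,
  E (fun w => g (sgwalk X k.+1 w)) = erw_mean p k g.
Proof.
move=> X1 Xs; elim=> [|k IH] km g.
  under eq_Rintegral do rewrite sgwalk1 -[sg X 1 _]add0r fun_sg.
  have f1 : fin_rv measurable (sg X 1) by exact: fin_rv_sgT.
  rewrite meanD; [|exact: fin_rv_cst|].
    by rewrite (meanZ P _ f1) mean_cst (mean_sg1 X1) !add0r /=; field.
  exact: (fin_rv1 (fun x => (g (0 + 1) - g (0 - 1)) / 2 * x)).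
have Xk : pm1_upto X k.+1.
  apply: (full_pm1 _ X1) => // j /andP[j1 j2]; apply: Xs.
  by rewrite j1 (leq_trans j2)// ltnW.
pose Z w := (g (sgwalk X k.+1 w + 1) - g (sgwalk X k.+1 w - 1)) / 2.
pose a := 2 * p - 1.
have fZ : fin_rv (past_gen X k.+1) Z.
  exact: (fin_rv_past_fun X (fun x => (g (x + 1) - g (x - 1)) / 2)).
transitivity (E (fun w => (g (sgwalk X k.+1 w + 1) + g (sgwalk X k.+1 w - 1)) / 2
    + Z w * sg X k.+2 w)).
  by apply: eq_Rintegral => w _; rewrite sgwalkS fun_sg.
rewrite meanD.
- have st : erw_step p X k.+1 k.+1 by apply: Xs; rewrite km.
  rewrite (erw_step_mean _ Xk st fZ) ?leqnn//.
  rewrite /= -IH; last exact: ltnW.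
  have f1 := fin_rv_fun X k.+1 (fun x => (g (x + 1) - g (x - 1)) / 2 * x).
  rewrite -[X in _ + X](meanZ P _ f1) -meanD.
  + by apply: eq_Rintegral => w _; rewrite /erw_op /Z; field; rewrite nat1r pnatr_eq0.
  + exact: (fin_rv_fun X k.+1 (fun x => (g (x + 1) + g (x - 1)) / 2)).
  + exact: (fin_rv_fun X k.+1 (fun x => _ * ((g (x + 1) - g (x - 1)) / 2 * x))).
- exact: (fin_rv_fun X k.+1 (fun x => (g (x + 1) + g (x - 1)) / 2)).
- apply: (fin_rv2 (fun x y => x * y)); first exact: (fin_rv_past fZ).
  exact: fin_rv_sgT.
Qed.

(** Given the first [m] steps, the later ones have mean [(2 * p - 1) * S_m / m];
    this is the part of the position at time [m + j] that they do not
    predict. *)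
Definition excess p X m j w : R :=
  sgwalk X (m + j) w - (1 + j%:R * (2 * p - 1) / m%:R) * sgwalk X m w.

(** The increments of [excess] are centred given the past, hence orthogonal to
    its previous value, and bounded by 2. *)
Lemma excess_mean_sqr (p : R) m n X : 0 <= p <= 1 -> (0 < m <= n)%N ->
  restricted_erw p m n X -> forall j, (m + j <= n)%N ->
  E (fun w => excess p X m j w ^+ 2) <= 4 * j%:R.
Proof.
move=> p01 mn rX; have /andP[m0 _] := mn.
have [_ _ Xs] := rX.
have mr0 : 0 < m%:R :> R by rewrite ltr0n.
have fU j : fin_rv (past_gen X (m + j)) (excess p X m j).
  apply: (fin_rv2 (fun x y => x - (1 + j%:R * (2 * p - 1) / m%:R) * y)).
    exact: fin_rv_sgwalk.
  by apply: fin_rv_sgwalk; exact: leq_addr.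
elim=> [|j IH] mj.
  rewrite mulr0 (_ : (fun w => _) = (fun=> 0)) ?mean_cst//.
  by apply/funext => w; rewrite /excess addn0 mul0r mul0r addr0 mul1r subrr expr0n.
have mj' : (m + j <= n)%N by rewrite (leq_trans _ mj)// addnS.
have mj'' : (m + j < n)%N by rewrite (leq_trans _ mj)// addnS.
have Xk : pm1_upto X (m + j).
  by apply: (restricted_pm1 mn rX); rewrite leq_addr.
have st : erw_step p X (m + j) m by apply: Xs; rewrite leq_addr.
pose a := 2 * p - 1.
pose S w := sgwalk X m w.
pose D w := sg X (m + j).+1 w - a / m%:R * S w.
have US w : excess p X m j.+1 w = excess p X m j w + D w.
  by rewrite /excess addnS sgwalkS /D /S -/a -natr1; field; rewrite gt_eqF.
have Sle w : `|S w| <= m%:R.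
  rewrite /S /sgwalk; apply: (le_trans (ler_norm_sum _ _ _)).
  apply: (@le_trans _ _ (\sum_(1 <= i < m.+1) 1)).
    by apply: ler_sum => i _; case: (sg_pm1 X i w) => ->; rewrite ?normrN normr1.
  by rewrite sumr_const_nat subn1.
have D2 w : D w ^+ 2 <= 4.
  have : `|D w| <= 2.
    rewrite /D; apply: (le_trans (ler_normB _ _)).
    have -> : (2 : R) = 1 + 1 by [].
    apply: lerD; first by case: (sg_pm1 X (m + j).+1 w) => ->; rewrite ?normrN normr1.
    rewrite !normrM normfV (gtr0_norm mr0) -mulrA.
    rewrite -[leRHS]mulr1 ler_pM ?mulr_ge0 ?invr_ge0//.
      by rewrite ler_norml /a; case/andP: p01 => ? ?; apply/andP; split; lra.
    by rewrite ler_pdivrMl// mulr1.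
  by rewrite ler_norml => /andP[? ?]; nra.
have fS : fin_rv (past_gen X (m + j)) S.
  by apply: fin_rv_sgwalk; exact: leq_addr.
have fsg : fin_rv measurable (sg X (m + j).+1) by exact: fin_rv_sgT.
have fD : fin_rv measurable D.
  apply: (fin_rv2 (fun x y => x - a / m%:R * y)) => //; exact: (fin_rv_past fS).
have fU' := fin_rv_past (fU j).
have UD : E (fun w => excess p X m j w * D w) = 0.
  transitivity (E (fun w => excess p X m j w * sg X (m + j).+1 w +
      - (a / m%:R) * (excess p X m j w * S w))).
    by apply: eq_Rintegral => w _; rewrite /D; ring.
  rewrite meanD.
  - rewrite (erw_step_mean _ Xk st (fU j)); last by rewrite m0 leq_addr.
    rewrite meanZ; last first.
      apply: (fin_rv2 (fun x y => x * y)) => //; exact: (fin_rv_past fS).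
    by rewrite -/a /S; ring.
  - exact: (fin_rv2 (fun x y => x * y)).
  - by apply: (fin_rv2 (fun x y => _ * (x * y))) => //; exact: (fin_rv_past fS).
have -> : E (fun w => excess p X m j.+1 w ^+ 2) =
    E (fun w => excess p X m j w ^+ 2) + E (fun w => D w ^+ 2).
  transitivity (E (fun w => (excess p X m j w ^+ 2 + D w ^+ 2) +
      2 * (excess p X m j w * D w))).
    by apply: eq_Rintegral => w _; rewrite US; ring.
  rewrite meanD.
  - rewrite meanZ; last exact: (fin_rv2 (fun x y => x * y)).
    rewrite UD mulr0 addr0 meanD//; first exact: (fin_rv1 (fun x => x ^+ 2)).
    exact: (fin_rv1 (fun x => x ^+ 2)).
  - exact: (fin_rv2 (fun x y => x ^+ 2 + y ^+ 2)).
  - exact: (fin_rv2 (fun x y => 2 * (x * y))).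
rewrite -[j.+1%:R]natr1 mulrDr mulr1 lerD ?IH//.
rewrite -[leRHS](mean_cst P 4); apply: mean_le => //.
- exact: (fin_rv1 (fun x => x ^+ 2)).
- exact: fin_rv_cst.
Qed.

(** [4 * s * `|u| <= u ^+ 2 + 4 * s ^+ 2] with [s = Num.sqrt n]. *)
Lemma excess_mean_norm (p : R) m n X : 0 <= p <= 1 -> (0 < m <= n)%N ->
  restricted_erw p m n X ->
  E (fun w => `|excess p X m (n - m) w|) <= 2 * Num.sqrt n%:R.
Proof.
move=> p01 mn rX; have /andP[m0 mn'] := mn.
have n0 : (0 < n)%N by exact: leq_trans mn'.
have := excess_mean_sqr p01 mn rX (j := (n - m)%N).
rewrite subnKC// leqnn => /(_ isT) h.
have s0 : 0 < Num.sqrt n%:R :> R by rewrite sqrtr_gt0 ltr0n.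
have fU : fin_rv measurable (excess p X m (n - m)).
  apply: (@fin_rv_past _ _ _ P X n).
  apply: (fin_rv2 (fun x y => x - (1 + (n - m)%:R * (2 * p - 1) / m%:R) * y)).
    by apply: fin_rv_sgwalk; rewrite subnKC.
  exact: fin_rv_sgwalk.
move: s0; set s : R := Num.sqrt _ => s0.
have sE : s ^+ 2 = n%:R by rewrite sqr_sqrtr.
apply: (@le_trans _ _ (E (fun w => (4 * s)^-1 * excess p X m (n - m) w ^+ 2 + s))).
  apply: mean_le.
  - exact: (fin_rv1 (fun x => `|x|)).
  - exact: (fin_rv1 (fun x => (4 * s)^-1 * x ^+ 2 + s)).
  - move=> w; rewrite -(real_normK (num_real (excess _ _ _ _ _))).
    move: (`|_|) => u.
    rewrite -(ler_pM2l (_ : 0 < 4 * s)) ?mulr_gt0// mulrDr mulrA divff ?gt_eqF ?mulr_gt0//.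
    by rewrite mul1r; have := sqr_ge0 (u - 2 * s); lra.
rewrite meanD; [|exact: (fin_rv1 (fun x => (4 * s)^-1 * x ^+ 2))|exact: fin_rv_cst].
rewrite meanZ; last exact: (fin_rv1 (fun x => x ^+ 2)).
rewrite mean_cst [leRHS](_ : _ = s + s); last by ring.
rewrite lerD2r ler_pdivrMl ?mulr_gt0//.
apply: (le_trans h); rewrite -mulrA -expr2 sE ler_wpM2l// ler_nat.
exact: leq_subr.
Qed.

(** [Phi] is Lipschitz, so the unpredicted part of the walk costs at most its mean
    absolute value. *)
Lemma restricted_compare (p : R) m n X (alpha eps x0 : R) : 0 <= p <= 1 ->
  (0 < m <= n)%N -> restricted_erw p m n X -> 0 <= alpha -> 0 < eps ->
  `|E (fun w => Phi ((x0 - alpha * sgwalk X n w) / eps)) -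
    erw_mean p m.-1 (fun x => Phi
      ((x0 - alpha * (1 + (n - m)%:R * (2 * p - 1) / m%:R) * x) / eps))| <=
  alpha * (2 * Num.sqrt n%:R) / eps.
Proof.
move=> p01 mn rX a0 eps0; have /andP[m0 mn'] := mn.
have [X1 Xs _] := rX.
set r := 1 + _.
have m1 : (m.-1 < m)%N by rewrite ltn_predL.
have := full_erw_law X1 Xs m1 (fun x => Phi ((x0 - alpha * r * x) / eps)).
rewrite prednK// => <-.
have f1 := fin_rv_fun X n (fun x => Phi ((x0 - alpha * x) / eps)).
have f2 := fin_rv_fun X m (fun x => Phi ((x0 - alpha * r * x) / eps)).
rewrite -[X in _ - X]mul1r -mulNr -meanZ// -meanD//; last first.
  exact: (fin_rv1 (fun x => -1 * x)).
have f3 := fin_rv2 (fun x y => x + -1 * y) f1 f2.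
apply: (le_trans (mean_norm P f3)).
apply: (@le_trans _ _ (E (fun w => alpha / eps * `|excess p X m (n - m) w|))).
  apply: mean_le.
  - exact: (fin_rv2 (fun x y => `|x + -1 * y|)).
  - apply: (fin_rv2 (fun x y => alpha / eps * `|x - r * y|)).
      by rewrite subnKC//; exact: (fin_rv_fun X n id).
    exact: (fin_rv_fun X m id).
  - move=> w; rewrite mulN1r; apply: (le_trans (Phi_lip _ _)).
    rewrite -mulrBl /excess subnKC// -/r.
    have -> : x0 - alpha * sgwalk X n w - (x0 - alpha * r * sgwalk X m w) =
      - (alpha * (sgwalk X n w - r * sgwalk X m w)) by ring.
    by rewrite normrM normrN normrM normfV (ger0_norm a0) (gtr0_norm eps0) mulrAC.
rewrite meanZ; last first.
  apply: (fin_rv2 (fun x y => `|x - r * y|)).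
    by rewrite subnKC//; exact: (fin_rv_fun X n id).
  exact: (fin_rv_fun X m id).
rewrite [leRHS]mulrAC ler_wpM2l ?divr_ge0 ?(ltW eps0)//.
exact: excess_mean_norm mn rX.
Qed.

End laws.

(** * From smooth test functions to distribution functions *)

Section smoothing.
Context {d : measure_display} {T : measurableType d} {R : realType}.
Variable P : probability T R.
Implicit Types (Y : {RV P >-> R}) (c x delta eps : R).

Local Notation E f := (Rintegral P setT f).

Lemma Phi_tail eta : 0 < eta ->
  exists A : R, [/\ 0 < A, 1 - Phi A <= eta & Phi (- A) <= eta].
Proof.
move=> eta0.
have h1 : \forall x \near +oo, 1 - Phi x <= eta.
  have : 1 - Phi x @[x --> +oo] --> (0 : R).
    rewrite -[X in _ --> X](subrr 1); apply: cvgB; first exact: cvg_cst.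
    exact: (law_cdf_cvgy (normal_prob 0 1)).
  by move/cvgr_le; exact.
have h2 : \forall x \near +oo, Phi (- x) <= eta.
  have : Phi (- x) @[x --> +oo] --> (0 : R).
    have := law_cdf_cvgNy (normal_prob (0 : R) 1).
    by move/cvgNy_compNP.
  by move/cvgr_le; exact.
have [A [A0 [hA1 hA2]]] : exists A : R, 0 < A /\ 1 - Phi A <= eta /\ Phi (- A) <= eta.
  have [A] := @filter_ex _ (+oo : set_system R) _ _
    (filterI (filterI h1 h2) (nbhs_pinfty_gt (num_real 0))).
  by move=> [[? ?] ?]; exists A.
by exists A.
Qed.

Lemma measurable_smooth c eps Y :
  measurable_fun setT (fun w => Phi ((c - Y w) / eps)).
Proof.
apply: (measurableT_comp (f := Phi)).
  by apply: continuous_measurable_fun; exact: continuous_Phi.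
apply: measurable_funM => //; apply: measurable_funB => //.
Qed.

Lemma integrable_smooth c eps Y :
  P.-integrable setT (EFin \o (fun w => Phi ((c - Y w) / eps))).
Proof.
apply: measurable_bounded_integrable => //.
- by apply: (@le_lt_trans _ _ 1%E); [exact: probability_le1|exact: ltry].
- exact: measurable_smooth.
- exists 1; split; first exact: num_real.
  move=> M M1 w _ /=; rewrite ger0_norm ?Phi_ge0//.
  by apply: (le_trans (Phi_le1 _)); exact: ltW.
Qed.

Lemma integrable_indic_cdf x Y : P.-integrable setT
  (EFin \o (\1_(Y @^-1` `]-oo, x]) : T -> R)).
Proof.
by apply: fin_rv_integrable; apply: fin_rv_indic; exact: preimage_meas.
Qed.

Lemma cdfE x Y : fine (cdf Y x) = E (\1_(Y @^-1` `]-oo, x]) : T -> R).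
Proof. by rewrite mean_indic//; exact: preimage_meas. Qed.

Lemma integrable_cst c : P.-integrable setT (EFin \o (fun=> c)).
Proof. by apply: fin_rv_integrable; exact: fin_rv_cst. Qed.

(** Where [Y <= x] the test function centred at [x + delta] is at least
    [Phi (delta / eps)]. *)
Lemma cdf_le_smooth x delta eps Y : 0 < eps ->
  fine (cdf Y x) <= E (fun w => Phi ((x + delta - Y w) / eps)) + (1 - Phi (delta / eps)).
Proof.
move=> eps0; rewrite cdfE -[X in _ <= _ + X](mean_cst P) -RintegralD//; last 2 first.
- exact: integrable_smooth.
- exact: integrable_cst.
apply: le_Rintegral => //.
- exact: integrable_indic_cdf.
- apply: (@integrableD _ _ _ P setT _ (EFin \o (fun w => Phi ((x + delta - Y w) / eps)))
    (EFin \o (fun=> 1 - Phi (delta / eps)))) => //.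
    exact: integrable_smooth.
  exact: integrable_cst.
move=> w _ /=; have [wY|wY] := boolP (w \in _).
  have {}wY : Y w <= x by move: wY; rewrite inE/= in_itv.
  rewrite /= addrCA lerDl subr_ge0; apply: ler_Phi.
  by rewrite ler_pM2r ?invr_gt0//; lra.
by rewrite addr_ge0 ?Phi_ge0// subr_ge0 Phi_le1.
Qed.

(** Where [Y > x] the test function centred at [x - delta] is at most
    [Phi (- (delta / eps))]. *)
Lemma smooth_le_cdf x delta eps Y : 0 < eps ->
  E (fun w => Phi ((x - delta - Y w) / eps)) <= fine (cdf Y x) + Phi (- (delta / eps)).
Proof.
move=> eps0; rewrite cdfE -[X in _ <= _ + X](mean_cst P) -RintegralD//; last 2 first.
- exact: integrable_indic_cdf.
- exact: integrable_cst.
apply: le_Rintegral => //.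
- exact: integrable_smooth.
- apply: (@integrableD _ _ _ P setT _ (EFin \o (\1_(Y @^-1` `]-oo, x]) : T -> R))
    (EFin \o (fun=> Phi (- (delta / eps))))) => //.
    exact: integrable_indic_cdf.
  exact: integrable_cst.
move=> w _ /=; have [wY|wY] := boolP (w \in _).
  by rewrite /= ler_wpDr ?Phi_ge0 ?Phi_le1.
have {}wY : x < Y w by move: wY; rewrite notin_setE/= in_itv/= => /negP; rewrite -ltNge.
rewrite add0r; apply: ler_Phi.
by rewrite -mulNr ler_pM2r ?invr_gt0//; lra.
Qed.

End smoothing.

Section cvg_criterion.
Context {R : realType}.

(** The limits [G] of the expectations of the test functions need not be known to
    be integrals against [mu]: it suffices that they are close to the
    distribution function of [mu] for small [delta] and [eps]. *)
Lemma cvg_in_distribution_smooth (d : nat -> measure_display)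
    (T : forall n : nat, measurableType (d n))
    (P : forall n : nat, probability (T n) R)
    (Y : forall n : nat, {RV (P n) >-> R}) (mu : set R -> \bar R) (G : R -> R -> R) :
  (forall x eps : R, 0 < eps ->
    Rintegral (P n) setT (fun w => Phi ((x - Y n w) / eps)) @[n --> \oo] --> G x eps) ->
  (forall x eta : R, {for x, continuous (law_cdf mu)} -> 0 < eta ->
    exists delta eps : R, [/\ 0 < eps, 1 - Phi (delta / eps) <= eta,
      Phi (- (delta / eps)) <= eta, G (x + delta) eps <= law_cdf mu x + eta &
      law_cdf mu x - eta <= G (x - delta) eps]) ->
  cvg_in_distribution P Y mu.
Proof.
move=> YG muG x xc; apply/cvgrPdist_le => eta eta0.
have e3 : 0 < eta / 3 by rewrite divr_gt0.
have [delta [eps [eps0 t1 t2 up lo]]] := muG _ _ xc e3.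
have h1 := YG (x + delta) _ eps0; have h2 := YG (x - delta) _ eps0.
have {}h1 : \forall n \near \oo, Rintegral (P n) setT
    (fun w => Phi ((x + delta - Y n w) / eps)) <= G (x + delta) eps + eta / 3.
  by move/cvgr_le : h1; apply; rewrite ltrDl.
have {}h2 : \forall n \near \oo, G (x - delta) eps - eta / 3 <= Rintegral (P n) setT
    (fun w => Phi ((x - delta - Y n w) / eps)).
  by move/cvgr_ge : h2; apply; rewrite gtrBl.
near=> n.
have k1 : Rintegral (P n) setT
    (fun w => Phi ((x + delta - Y n w) / eps)) <= G (x + delta) eps + eta / 3 by near: n.
have k2 : G (x - delta) eps - eta / 3 <= Rintegral (P n) setT
    (fun w => Phi ((x - delta - Y n w) / eps)) by near: n.
have := cdf_le_smooth x delta (Y n) eps0; have := smooth_le_cdf x delta (Y n) eps0.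
move: k1 k2 t1 t2 up lo; move: (law_cdf mu x) (fine _) (G _ _) (G _ _) (Rintegral _ _ _) (Rintegral _ _ _).
by move=> *; rewrite ler_norml; apply/andP; split; lra.
Unshelve. all: by end_near. Qed.

End cvg_criterion.

Section limit_laws.
Context {R : realType}.
Implicit Types (x eta v : R).

Lemma dirac0_cdf x : law_cdf (\d_(0 : R) : set R -> \bar R) x = if 0 <= x then 1 else 0.
Proof.
rewrite /law_cdf diracE; case: (leP 0 x) => x0.
  by rewrite mem_set//= in_itv.
by rewrite memNset//= in_itv /= leNgt x0.
Qed.

(** The quotient [delta / eps] is fixed, large enough for the tails of [Phi],
    and [delta] is small.  In the degenerate case [x] is not 0, where the
    distribution function jumps, and [delta] is half its distance to 0. *)
Lemma gaussian_criterion v x eta : 0 <= v ->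
  {for x, continuous (law_cdf (centered_gaussian v))} -> 0 < eta ->
  exists delta eps : R, [/\ 0 < eps, 1 - Phi (delta / eps) <= eta,
    Phi (- (delta / eps)) <= eta,
    Phi ((x + delta) / Num.sqrt (eps ^+ 2 + v)) <= law_cdf (centered_gaussian v) x + eta &
    law_cdf (centered_gaussian v) x - eta <= Phi ((x - delta) / Num.sqrt (eps ^+ 2 + v))].
Proof.
move=> v0 xc eta0; have [A [A0 t1 t2]] := Phi_tail eta0.
have An0 : A != 0 by rewrite gt_eqF.
have dA (y : R) : 0 < y -> y / (y / A) = A.
  by move=> y0; rewrite invf_div mulrCA divff ?mulr1// gt_eqF.
move: v0; rewrite le_eqVlt => /predU1P[v0|v0].
  move: xc; rewrite /centered_gaussian -v0 eqxx => xc.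
  have x0 : x != 0.
    apply/eqP => x0; move: xc; rewrite x0 => xc.
    have h : - (n.+1%:R : R)^-1 @[n --> \oo] --> (0 : R).
      by rewrite -oppr0; apply: cvgN; exact: cvg_invS.
    have := cvg_seq_continuous h xc; rewrite dirac0_cdf lexx.
    under eq_fun do rewrite dirac0_cdf oppr_ge0 leNgt invr_gt0 ltr0n /=.
    move=> h1; have h2 : (1 : R) = 0.
      exact: (cvg_unique (@Rhausdorff R) h1 (@cvg_cst _ (0 : R) _ \oo _)).
    by move/eqP: h2; rewrite oner_eq0.
  have sq (y : R) : 0 < y -> Num.sqrt (y ^+ 2 + 0) = y.
    by move=> y0; rewrite addr0 sqrtr_sqr gtr0_norm.
  rewrite dirac0_cdf; have [xlt|xgt|xeq] := ltgtP x 0; last by rewrite xeq eqxx in x0.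
  - have d0 : 0 < - x / 2 by lra.
    exists (- x / 2), (- x / 2 / A); have e0 : 0 < - x / 2 / A by rewrite divr_gt0.
    rewrite sq// dA//; split => //; last by rewrite /=; have := Phi_ge0 ((x - - x / 2) / (- x / 2 / A)); lra.
    by rewrite (_ : x + - x / 2 = - (- x / 2)); [rewrite mulNr dA// add0r|lra].
  - have d0 : 0 < x / 2 by lra.
    exists (x / 2), (x / 2 / A); have e0 : 0 < x / 2 / A by rewrite divr_gt0.
    rewrite sq// dA//; split => //; first by have := Phi_le1 ((x + x / 2) / (x / 2 / A)); rewrite /=; lra.
    by rewrite (_ : x - x / 2 = x / 2); [rewrite dA// /=; lra|lra].
rewrite /centered_gaussian gt_eqF// normal_cdfE ?sqrtr_gt0//.
pose dl (n : nat) : R := (n.+1%:R)^-1.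
have dl0 : dl n @[n --> \oo] --> (0 : R) by exact: cvg_invS.
have key s : Phi ((x + s * dl n) / Num.sqrt ((dl n / A) ^+ 2 + v)) @[n --> \oo] -->
    Phi (x / Num.sqrt v).
  apply: (cvg_seq_continuous _ (@continuous_Phi _ _)).
  have h1 : x + s * dl n @[n --> \oo] --> x.
    by rewrite -[X in _ --> X]addr0 -[X in _ --> _ + X](mulr0 s);
      apply: cvgD (cvg_cst _) (cvgM (cvg_cst _) dl0).
  have h2 : (dl n / A) ^+ 2 + v @[n --> \oo] --> v.
    have h3 : dl n / A @[n --> \oo] --> (0 : R).
      by rewrite -[X in _ --> X](mul0r A^-1); apply: cvgM dl0 (cvg_cst _).
    have h4 : (dl n / A) ^+ 2 @[n --> \oo] --> (0 : R).
      by rewrite -[X in _ --> X](mulr0 0); exact: (cvgM h3).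
    by rewrite -[X in _ --> X]add0r; apply: cvgD h4 (cvg_cst _).
  have h5 := cvg_seq_continuous h2 (@sqrt_continuous R _).
  have h6 : Num.sqrt v != 0 by rewrite gt_eqF// sqrtr_gt0.
  by apply: cvgM h1 (cvgV h6 h5).
have h1 : \forall n \near \oo, Phi ((x + 1 * dl n) / Num.sqrt ((dl n / A) ^+ 2 + v))
    <= Phi (x / Num.sqrt v) + eta.
  by move/cvgr_le : (key 1); apply; rewrite ltrDl.
have h2 : \forall n \near \oo, Phi (x / Num.sqrt v) - eta <=
    Phi ((x + -1 * dl n) / Num.sqrt ((dl n / A) ^+ 2 + v)).
  by move/cvgr_ge : (key (-1)); apply; rewrite gtrBl.
have [n [n1 n2]] := filter_ex (filterI h1 h2).
have dn0 : 0 < dl n by rewrite invr_gt0.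
exists (dl n), (dl n / A); rewrite dA//; split => //.
- by rewrite divr_gt0.
- by rewrite mul1r in n1.
- by rewrite mulN1r in n2.
Qed.

(** The smoothing inequalities at [x + 2 * delta] and [x - 2 * delta]. *)
Lemma distribution_criterion (d : measure_display) (T : measurableType d)
    (P : probability T R) (Y : {RV P >-> R}) x eta :
  {for x, continuous (law_cdf (distribution P Y))} -> 0 < eta ->
  exists delta eps : R, [/\ 0 < eps, 1 - Phi (delta / eps) <= eta,
    Phi (- (delta / eps)) <= eta,
    Rintegral P setT (fun w => Phi ((x + delta - Y w) / eps)) <=
      law_cdf (distribution P Y) x + eta &
    law_cdf (distribution P Y) x - eta <=
      Rintegral P setT (fun w => Phi ((x - delta - Y w) / eps))].
Proof.
move=> xc eta0; have e2 : 0 < eta / 2 by rewrite divr_gt0.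
have [A [A0 t1 t2]] := Phi_tail e2.
move/cvgrPdist_le : xc => /(_ _ e2) /nbhs_ballP[r /= r0 hr].
pose delta := r / 4; have d0 : 0 < delta by rewrite divr_gt0.
have dA : delta / (delta / A) = A.
  by rewrite invf_div mulrCA divff ?mulr1// gt_eqF.
have eps0 : 0 < delta / A by rewrite divr_gt0.
exists delta, (delta / A); rewrite dA; split => //.
- by apply: (le_trans t1); lra.
- by apply: (le_trans t2); lra.
- have := smooth_le_cdf (x + 2 * delta) delta Y eps0; rewrite dA.
  have -> : x + 2 * delta - delta = x + delta by ring.
  have := hr (x + 2 * delta).
  rewrite /ball/= opprD addNKr normrN gtr0_norm ?mulr_gt0// => /(_ _).
  have -> : 2 * delta < r by rewrite /delta; lra.
  move=> /(_ isT); rewrite ler_norml => /andP[+ _].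
  rewrite /law_cdf -/(cdf Y (x + 2 * delta)) -/(cdf Y x).
  by move: (fine _) (fine _) (Rintegral _ _ _) => *; lra.
- have := cdf_le_smooth (x - 2 * delta) delta Y eps0; rewrite dA.
  have -> : x - 2 * delta + delta = x - delta by ring.
  have := hr (x - 2 * delta).
  rewrite /ball/= opprB addrC subrK gtr0_norm ?mulr_gt0// => /(_ _).
  have -> : 2 * delta < r by rewrite /delta; lra.
  move=> /(_ isT); rewrite ler_norml => /andP[_].
  rewrite /law_cdf -/(cdf Y (x - 2 * delta)) -/(cdf Y x).
  by move: (fine _) (fine _) (Rintegral _ _ _) => *; lra.
Qed.

End limit_laws.

(** * The walk with restricted memory *)

Section smooth_walk.
Context {d : measure_display} {T : measurableType d} {R : realType}.
Variable P : probability T R.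

Lemma smooth_walkE (X : nat -> {RV P >-> R}) n (x alpha eps : R) : pm1_upto X n ->
  Rintegral P setT (fun w => Phi ((x - scale_mfun alpha (walk X n) w) / eps)) =
  Rintegral P setT (fun w => Phi ((x - alpha * sgwalk X n w) / eps)).
Proof.
move=> Xn; apply: Rintegral_ae_eq.
- exact: measurable_smooth.
- apply: fin_rv_measurable.
  exact: (fin_rv_fun X n (fun y => Phi ((x - alpha * y) / eps))).
- by apply: filterS (walk_sgwalk Xn) => w wE; rewrite /scale_mfun /= wE (mulrC alpha).
Qed.

End smooth_walk.

Section reduction.
Context {R : realType}.
Variables (p : R) (m : nat -> nat) (d : nat -> measure_display)
  (T : forall n : nat, measurableType (d n))
  (P : forall n : nat, probability (T n) R)
  (X : forall n : nat, nat -> {RV (P n) >-> R}).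
Hypotheses (p01 : 0 <= p <= 1)
  (hm : forall n : nat, (1 <= n)%N -> (1 <= m n <= n)%N)
  (hmoo : m n @[n --> \oo] --> \oo)
  (hmn : (m n)%:R / n%:R @[n --> \oo] --> (0 : R))
  (hX : forall n : nat, (1 <= n)%N -> restricted_erw p (m n) n (X n)).

(** This is [(1 + (n - m) * (2 * p - 1) / m) * m / n], the factor that carries
    the first [m] steps to time [n]. *)
Definition memory_weight n : R :=
  (m n)%:R / n%:R + (1 - (m n)%:R / n%:R) * (2 * p - 1).

Lemma memory_weight_cvg : memory_weight n @[n --> \oo] --> 2 * p - 1.
Proof.
have h : 1 - (m n)%:R / n%:R @[n --> \oo] --> (1 : R).
  by rewrite -[X in _ --> X]subr0; apply: cvgB hmn; exact: cvg_cst.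
rewrite /memory_weight -[X in _ --> X]add0r -[X in _ --> _ + X]mul1r.
exact: cvgD hmn (cvgM h (cvg_cst _)).
Qed.

Lemma pred_memory_cvg : (m n).-1 @[n --> \oo] --> \oo.
Proof.
apply/cvgnyPge => A; move/cvgnyPge : hmoo => /(_ A.+1); apply: filterS => n.
by case: (m n).
Qed.

(** The error of [restricted_compare] is of order [alpha n * Num.sqrt n]. *)
Lemma restricted_smooth (alpha : nat -> R) (x eps : R) :
  (forall n, 0 <= alpha n) -> alpha n * Num.sqrt n%:R @[n --> \oo] --> (0 : R) ->
  0 < eps ->
  Rintegral (P n) setT (fun w => Phi ((x - scale_mfun (alpha n) (walk (X n) n) w) / eps)) -
  erw_mean p (m n).-1 (fun y => Phi
    ((x - memory_weight n * (alpha n * n%:R / (m n)%:R) * y) / eps))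
  @[n --> \oo] --> (0 : R).
Proof.
move=> a0 acvg eps0; apply/norm_cvg0P.
apply: (@squeeze_cvgr _ _ _ _ (fun=> 0)
  (fun n => 2 / eps * (alpha n * Num.sqrt n%:R))); last 2 first.
- exact: cvg_cst.
- by rewrite -[X in _ --> X](mulr0 (2 / eps)); apply: cvgM acvg; exact: cvg_cst.
near=> n; rewrite normr_ge0 /=.
have n0 : (1 <= n)%N by near: n; exact: nbhs_infty_ge.
have mn := hm n0; have /andP[m0 mn'] := mn.
have := restricted_compare x p01 mn (hX n0) (a0 n) eps0.
have -> : alpha n * (1 + (n - m n)%:R * (2 * p - 1) / (m n)%:R) =
    memory_weight n * (alpha n * n%:R / (m n)%:R).
  rewrite /memory_weight natrB//; field.
  by rewrite !pnatr_eq0 -!lt0n m0.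
move=> h; have Xn : pm1_upto (X n) n.
  by apply: (restricted_pm1 mn (hX n0)); rewrite mn' leqnn.
rewrite (smooth_walkE x (alpha n) eps Xn); apply: (le_trans h).
by rewrite le_eqVlt; apply/orP; left; apply/eqP; ring.
Unshelve. all: by end_near. Qed.

Lemma restricted_clt (alpha : nat -> R) w lambda b :
  0 < p -> p <= 3 / 4 -> scaling (2 * p - 1) w lambda b ->
  (forall n, 0 <= alpha n) -> alpha n * Num.sqrt n%:R @[n --> \oo] --> (0 : R) ->
  (forall n, (0 < n)%N -> alpha n * n%:R / (m n)%:R = (Num.sqrt (w (m n).-1))^-1) ->
  cvg_in_distribution P (fun n => scale_mfun (alpha n) (walk (X n) n))
    (centered_gaussian ((2 * p - 1) ^+ 2 / lambda)).
Proof.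
move=> p0 p34 S a0 acvg aw.
have l0 : 0 < lambda by case: S.
apply: (@cvg_in_distribution_smooth _ _ _ _ _ _ (fun x eps =>
  Phi (x / Num.sqrt (eps ^+ 2 + (2 * p - 1) ^+ 2 / lambda)))); last first.
  move=> x eta xc eta0; apply: gaussian_criterion => //.
  by rewrite divr_ge0 ?sqr_ge0// ltW.
move=> x eps eps0.
have h1 := restricted_smooth x a0 acvg eps0.
have h2 := erw_clt (x0 := x) p0 p34 S pred_memory_cvg memory_weight_cvg eps0.
apply: (cvg_from_diff h1 h2); near=> n => /=.
have n0 : (0 < n)%N by near: n; exact: nbhs_infty_ge.
by rewrite aw.
Unshelve. all: by end_near. Qed.

(** The walk [X'] has the same law as the first [m n] steps of [X n], and on its
    own space it converges almost surely, so dominated convergence applies. *)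
Lemma restricted_superdiffusive (alpha : nat -> R)
    (d' : measure_display) (T' : measurableType d') (P' : probability T' R)
    (X' : nat -> {RV P' >-> R}) (L : {RV P' >-> R}) :
  (forall n, 0 <= alpha n) -> alpha n * Num.sqrt n%:R @[n --> \oo] --> (0 : R) ->
  (forall n, (0 < n)%N -> alpha n * n%:R / (m n)%:R = ((m n)%:R `^ (2 * p - 1))^-1) ->
  full_erw p X' ->
  {ae P', forall w, walk X' j w / j%:R `^ (2 * p - 1) @[j --> \oo] --> L w} ->
  cvg_in_distribution P (fun n => scale_mfun (alpha n) (walk (X n) n))
    (distribution P' (scale_mfun (2 * p - 1) L)).
Proof.
move=> a0 acvg aw [X1 Xs] XL.
apply: (@cvg_in_distribution_smooth _ _ _ _ _ _ (fun x eps =>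
  Rintegral P' setT (fun w => Phi ((x - scale_mfun (2 * p - 1) L w) / eps)))); last first.
  by move=> x eta xc eta0; exact: distribution_criterion.
move=> x eps eps0.
have h1 := restricted_smooth x a0 acvg eps0.
pose c n := memory_weight n / (m n)%:R `^ (2 * p - 1).
pose F n w := Phi ((x - scale_mfun (c n) (walk X' (m n)) w) / eps).
pose F' w := Phi ((x - scale_mfun (2 * p - 1) L w) / eps).
have h2 : Rintegral P' setT (F n) @[n --> \oo] --> Rintegral P' setT F'.
  have [|||||_ _ h] := @dominated_convergence _ T' R P' setT measurableT
    (fun n w => (F n w)%:E) (fun w => (F' w)%:E) (fun=> 1%E).
  - by move=> n; apply/measurable_EFinP; exact: measurable_smooth.
  - by apply/measurable_EFinP; exact: measurable_smooth.
  - apply: filterS XL => w wL _; apply: cvg_EFin; first exact: nearW.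
    apply: (cvg_seq_continuous _ (@continuous_Phi _ _)).
    have g1 : walk X' (m n) w / (m n)%:R `^ (2 * p - 1) @[n --> \oo] --> L w.
      by apply: (@cvg_comp _ _ _ m
        (fun j => walk X' j w / j%:R `^ (2 * p - 1)) _ \oo).
    have g2 : scale_mfun (c n) (walk X' (m n)) w @[n --> \oo] -->
        scale_mfun (2 * p - 1) L w.
      have -> : (fun n => scale_mfun (c n) (walk X' (m n)) w) =
          (fun n => walk X' (m n) w / (m n)%:R `^ (2 * p - 1) * memory_weight n).
        by apply/funext => n; rewrite /scale_mfun /= /c; ring.
      exact: cvgM g1 memory_weight_cvg.
    by apply: cvgM (cvgB (cvg_cst _) g2) (cvg_cst _).
  - exact: (@integrable_cst _ T' R P' 1).
  - apply: aeW => w n _ /=.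
    by rewrite lee_fin ger0_norm ?Phi_ge0// Phi_le1.
  - by apply: fine_cvg; rewrite fineK//; apply: integrable_fin_num => //; exact: integrable_smooth.
apply: (cvg_from_diff h1 h2); near=> n.
have n0 : (0 < n)%N by near: n; exact: nbhs_infty_ge.
have /andP[m0 mn] := hm n0.
have Xs' k : (1 <= k < m n)%N -> erw_step p X' k k by move=> /andP[/Xs].
have m1 : ((m n).-1 < m n)%N by rewrite ltn_predL.
rewrite (aw _ n0) -(full_erw_law X1 Xs' m1) (prednK m0).
exact: (smooth_walkE _ _ _ (full_pm1 m0 X1 Xs')).
Unshelve. all: by end_near. Qed.

End reduction.

Theorem theorem3p1 (R : realType) (p : R) (m : nat -> nat)
  (d : nat -> measure_display) (T : forall n : nat, measurableType (d n))
  (P : forall n : nat, probability (T n) R)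
  (X : forall n : nat, nat -> {RV (P n) >-> R})
  (hp : 0 < p < 1)
  (hm : forall n : nat, (1 <= n)%N -> (1 <= m n <= n)%N)
  (hmoo : m n @[n --> \oo] --> \oo)
  (hmn : (m n)%:R / n%:R @[n --> \oo] --> (0 : R))
  (hX : forall n : nat, (1 <= n)%N -> restricted_erw p (m n) n (X n)) :
  [/\ p < 3 / 4 ->
        cvg_in_distribution P
          (fun n => scale_mfun (Num.sqrt (m n)%:R / n%:R) (walk (X n) n))
          (centered_gaussian ((2 * p - 1) ^+ 2 / (3 - 4 * p))),
      p = 3 / 4 ->
        cvg_in_distribution P
          (fun n => scale_mfun (Num.sqrt ((m n)%:R / ln (m n)%:R) / n%:R)
                       (walk (X n) n))
          (centered_gaussian (1 / 4)) &
      3 / 4 < p ->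
        forall (d' : measure_display) (T' : measurableType d')
          (P' : probability T' R) (X' : nat -> {RV P' >-> R})
          (L : {RV P' >-> R}),
        full_erw p X' ->
        {ae P', forall w,
           walk X' j w / j%:R `^ (2 * p - 1) @[j --> \oo] --> L w} ->
        cvg_in_distribution P
          (fun n => scale_mfun ((m n)%:R `^ (2 * (1 - p)) / n%:R) (walk (X n) n))
          (distribution P' (scale_mfun (2 * p - 1) L))].
Proof.
have p01 : 0 <= p <= 1 by case/andP: hp => ? ?; apply/andP; split; lra.
have [p0 p1] := andP hp.
have sqrt_mn : Num.sqrt ((m n)%:R / n%:R) @[n --> \oo] --> (0 : R).
  by have := cvg_seq_continuous hmn (@sqrt_continuous R _); rewrite sqrtr0.
have sqrt_div (n : nat) : Num.sqrt n%:R / n%:R = (Num.sqrt n%:R)^-1 :> R.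
  have [->|n0] := eqVneq n 0%N; first by rewrite sqrtr0 mul0r invr0.
  rewrite -[X in _ / X](@sqr_sqrtr R n%:R)// expr2 invfM mulrA divff ?mul1r//.
  by rewrite gt_eqF// sqrtr_gt0 ltr0n lt0n.
have alpha_sqrt (beta : nat -> R) : (forall n, 0 <= beta n) ->
    (\forall n \near \oo, beta n <= Num.sqrt (m n)%:R) ->
    beta n / n%:R * Num.sqrt n%:R @[n --> \oo] --> (0 : R).
  move=> b0 bm; apply: (@squeeze_cvgr _ _ _ _ (fun=> 0)
    (fun n => Num.sqrt ((m n)%:R / n%:R))) => //; last exact: cvg_cst.
  near=> n; rewrite -mulrA (mulrC _^-1) sqrt_div mulr_ge0 ?invr_ge0 ?sqrtr_ge0//=.
  rewrite sqrtrM// sqrtrV// ler_wpM2r ?invr_ge0 ?sqrtr_ge0//.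
  by near: n.
have cancel_n (beta : nat -> R) n : (0 < n)%N ->
    beta n / n%:R * n%:R / (m n)%:R = beta n / (m n)%:R.
  by move=> n0; rewrite divfK// pnatr_eq0 -lt0n.
have m_gt0 n : (0 < n)%N -> (0 < m n)%N by move=> /hm /andP[].
split.
- move=> p34.
  have [b S] : exists b, scaling (2 * p - 1) (fun n => n.+1%:R) (1 - 2 * (2 * p - 1)) b.
    by apply: scaling_diffusive; lra.
  have -> : 3 - 4 * p = 1 - 2 * (2 * p - 1) by ring.
  apply: (restricted_clt p01 hm hmoo hmn hX p0 _ S).
  + exact: ltW.
  + by move=> n; rewrite divr_ge0// sqrtr_ge0.
  + by apply: alpha_sqrt => [n|]; [exact: sqrtr_ge0|exact: nearW].
  + move=> n n0; rewrite (cancel_n (fun n => Num.sqrt (m n)%:R))// sqrt_div.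
    by rewrite prednK// m_gt0.
- move=> p34; have S := @scaling_critical R.
  have a12 : 2 * p - 1 = 1 / 2 by rewrite p34; field.
  have -> : 1 / 4 = (2 * p - 1) ^+ 2 / 1 :> R by rewrite a12; field.
  apply: (restricted_clt p01 hm hmoo hmn hX p0 _ (w := fun n => n.+1%:R * ln n.+1%:R)
    (b := fun n => 2 * n.+1%:R - 1 / 2)).
  + by rewrite p34.
  + by rewrite a12.
  + by move=> n; rewrite divr_ge0// sqrtr_ge0.
  + apply: alpha_sqrt => [n|]; first exact: sqrtr_ge0.
    have : \forall n \near \oo, 1 <= ln ((m n).-1.+1%:R) :> R.
      have h := @cvg_comp _ _ _ (fun n => (m n).-1) (fun n => ln (n.+1%:R : R)) \oo _ _
        (pred_memory_cvg hmoo) (@ln_nat_cvgy R).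
      by move/cvgryPge : h; exact.
    move=> l1; near=> n.
    have n0 : (0 < n)%N by near: n; exact: nbhs_infty_ge.
    have l1n : 1 <= ln ((m n).-1.+1%:R) :> R by near: n.
    rewrite prednK ?m_gt0// in l1n.
    rewrite ler_sqrt// ler_pdivrMr ?(lt_le_trans ltr01)//.
    by rewrite ler_peMr.
  + move=> n n0; rewrite (cancel_n (fun n => Num.sqrt ((m n)%:R / ln (m n)%:R)))//.
    have mn0 := m_gt0 _ n0.
    rewrite prednK// sqrtrM// [in RHS]sqrtrM// sqrtrV; last first.
      by rewrite ln_ge0// ler1n.
    by rewrite mulrAC sqrt_div invfM.
- move=> p34 d' T' P' X' L fX' XL.
  apply: (restricted_superdiffusive p01 hm hmoo hmn hX _ _ _ fX' XL).
  + by move=> n; rewrite divr_ge0// powR_ge0.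
  + apply: alpha_sqrt => [n|]; first exact: powR_ge0.
    near=> n.
    have n0 : (0 < n)%N by near: n; exact: nbhs_infty_ge.
    rewrite -powR12_sqrt//; apply: ler_powR; last lra.
    by rewrite ler1n m_gt0.
  + move=> n n0; rewrite (cancel_n (fun n => (m n)%:R `^ (2 * (1 - p))))//.
    have mn0 : (0 : R) < (m n)%:R by rewrite ltr0n m_gt0.
    rewrite -powRN -[X in _ / X]powRr1 ?ltW// -powRB; last first.
      by apply/implyP => _; rewrite gt_eqF.
    by congr (_ `^ _); ring.
Unshelve. all: by end_near. Qed.
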